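(* There exists a unique isomorphism of graded monoids $\mathcal{M}ot\to\mathcal{E}$ from the monoid of Motzkin paths to the monoid of excessive multisegments which commutes with suspension. (Thus, composed with the inclusion $\mathcal{E}\subseteq\mathcal{M}$, it coincides with the unique injective homomorphism of graded monoids $\mathcal{M}ot\to\mathcal{M}$ commuting with suspension.)
   Context: Conventions: $\mathbb{N}$ contains $0$, and $[i,j]$ denotes the interval of integers from $i$ to $j$. A graded monoid is a monoid with a homomorphism to $\mathbb{N}$ (the degree); a homomorphism $\Phi$ of graded monoids preserves degree, and commutes with suspension if $\Phi(S(x))=S(\Phi(x))$ for all $x$. Motzkin paths. A Motzkin path of length $n\in\mathbb{N}$ is a map $\gamma:[0,n]\to\mathbb{N}$ with $\gamma(0)=\gamma(n)=0$ and $|\gamma(k)-\gamma(k+1)|\le 1$ for $k\in[0,n-1]$. $\mathcal{M}ot_n$ is the set of these and $\mathcal{M}ot=\coprod_{n\ge0}\mathcal{M}ot_n$. Concatenation: for $\gamma\in\mathcal{M}ot_p$, $\delta\in\mathcal{M}ot_q$, $\gamma\ast\delta\in\mathcal{M}ot_{p+q}$ is $\gamma(i)$ for $i\in[0,p]$ and $\delta(i-p)$ for $i\in[p,p+q]$. Suspension: for $\gamma\in\mathcal{M}ot_n$, $S(\gamma)\in\mathcal{M}ot_{n+2}$ is $0$ at $0$ and $n+2$, and $S(\gamma)(i)=\gamma(i-1)+1$ for $i\in[1,n+1]$. With $\ast$, $\mathcal{M}ot$ is a monoid graded by length. Multisegments. A multisegment over $[1,n]$ is a finite multiset of segments $[i,j]$,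 $1\le i\le j\le n$. For $n\ge1$, $\mathcal{R}_n$ is the set of multisegments over $[1,n]$ such that every $k\in[1,n]$ lies in exactly $n+1$ segments (with multiplicity); $\mathcal{R}_0$ consists of the empty multisegment; $\mathcal{R}=\coprod_{n\ge 0}\mathcal{R}_n$. For $1\le k\le n-1$, a segment $[i,j]$ contains the column $k$ if $i\le k<j$; $M\in\mathcal{R}_n$ has $c$ cuts at column $k$ if exactly $n+1-c$ of its segments contain the column $k$. $\mathcal{M}_n\subseteq\mathcal{R}_n$ is the set of multisegments with at most one cut at every column, $\mathcal{M}_0=\mathcal{R}_0$, $\mathcal{M}=\coprod_{n\ge0}\mathcal{M}_n$. Concatenation in $\mathcal{R}$: for $M\in\mathcal{R}_p$, $N\in\mathcal{R}_q$, $p,q\ge1$, $M\ast N\in\mathcal{R}_{p+q}$ consists of: (1) $[i,j]$ for each $[i,j]\in M$ with $j<p$; (2) $[i+p,j+p]$ for each $[i,j]\in N$ with $i>1$; (3) $[i_k,j_k+p]$ for $k=1,\dots,p+q+1$, where $[i_1,p],\dots,[i_{p+q+1},p]$ with $i_1\ge i_2\ge\cdots$ are the segments ending at $p$ in the multiset sum of $M$ and $q$ copies of $[1,p]$, and $[1,j_1],\dots,[1,j_{p+q+1}]$ with $j_1\le j_2\le\cdots$ are the segments starting at $1$ in the multiset sum of $N$ and $p$ copies of $[1,q]$. The empty multisegment is the identity for $\ast$. Suspension in $\mathcal{R}$: for $M\in\mathcal{R}_n$, $n>0$, $S(M)\in\mathcal{R}_{n+2}$ consists of $[i+1,j+1]$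 for each $[i,j]\in M$ with $1<i\le j<n$; $[1,j+1]$ for each $[1,j]\in M$ with $j<n$; $[i+1,n+2]$ for each $[i,n]\in M$ with $i>1$; $[1,n+2]$ for each $[1,n]\in M$; and the four segments $[1,1],[2,n+2],[1,n+1],[n+2,n+2]$. The suspension of the empty multisegment is $\{[1,1],[2,2],[1,2],[1,2]\}\in\mathcal{R}_2$. Excessive multisegments. A pair of segments $(A,B)$ is linked if $A$ begins strictly before $B$, $B$ ends strictly after $A$, and $A\cup B$ is a segment (interval of integers). It is quasi-linked if it is linked or $a+1=b-1$, where $a$ is the end of $A$ and $b$ the beginning of $B$. A triple $(A,B,C)$ is linked if $(A,B)$ and $(B,C)$ are linked and $(A,C)$ is quasi-linked. For $n>0$, $M\in\mathcal{M}_n$ is excessive if no triple of its segments is linked; $\mathcal{E}_n$ is the set of these, $\mathcal{E}_0=\mathcal{M}_0$, $\mathcal{E}=\coprod_{n\ge0}\mathcal{E}_n$. Both $\mathcal{M}$ and $\mathcal{E}$ are submonoids of $(\mathcal{R},\ast)$, graded by $n$ and stable by $S$. *)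

(* Defs.v *)
From HB Require Import structures.
From mathcomp Require Import all_boot.
From mathcomp Require Import ssralg ssrint.
From mathcomp Require Import finmap multiset.
From mathcomp Require Import zify.

Set Implicit Arguments.
Unset Strict Implicit.
Unset Printing Implicit Defensive.

Local Open Scope mset_scope.
Local Open Scope nat_scope.
Import IntDist.

HB.mixin Record isGraded G of Monoid G := {
  degree : G -> nat;
  degree1 : degree (1%g : G) = 0;
  degreeM : forall x y : G, degree (x * y)%g = degree x + degree y
}.

#[short(type="gradedMonoidType")]
HB.structure Definition GradedMonoid := {G of isGraded G & Monoid G}.

HB.mixin Record hasSuspension G of GradedMonoid G := {
  suspension : G -> G;
  degree_suspension : forall x : G, degree (suspension x) = degree x + 2
}.

#[short(type="suspMonoidType")]
HB.structure Definition SuspMonoid := {G of hasSuspension G & GradedMonoid G}.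

Definition graded_morphism (G H : gradedMonoidType) (f : G -> H) : Prop :=
  monoid_morphism f /\ (forall x, degree (f x) = degree x).

Definition graded_isomorphism (G H : gradedMonoidType) (f : G -> H) : Prop :=
  graded_morphism f /\
  exists g : H -> G, [/\ graded_morphism g, cancel f g & cancel g f].

Definition commutes_with_suspension (G H : suspMonoidType) (f : G -> H) : Prop :=
  forall x, f (suspension x) = suspension (f x).

Definition is_motzkin n (g : {ffun 'I_n.+1 -> nat}) : bool :=
  [&& g ord0 == 0, g ord_max == 0 &
      [forall k : 'I_n, `|g (inord k) - g (inord k.+1)| <= 1]].

Record motzkin_path n := MotzkinPath {
  path_fun :> {ffun 'I_n.+1 -> nat};
  _ : is_motzkin path_fun
}.

HB.instance Definition _ n := [isSub for @path_fun n].
HB.instance Definition _ n := [Choice of motzkin_path n by <:].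

Definition path_cat_fun p q (g : motzkin_path p) (d : motzkin_path q) :=
  [ffun i : 'I_(p + q).+1 =>
     if i <= p then g (inord i) else d (inord (i - p))].

Definition path_susp_fun n (g : motzkin_path n) :=
  [ffun i : 'I_(n + 2).+1 =>
     if (i == 0 :> nat) || (i == n + 2 :> nat) then 0 else (g (inord i.-1)).+1].

Lemma is_motzkinP n (g : {ffun 'I_n.+1 -> nat}) :
  reflect [/\ g (inord 0) = 0, g (inord n) = 0 &
    forall k, k < n -> g (inord k) <= (g (inord k.+1)).+1 /\
                       g (inord k.+1) <= (g (inord k)).+1]
    (is_motzkin g).
Proof.
have E0 : inord 0 = ord0 :> 'I_n.+1 by apply: val_inj; rewrite /= inordK.
have E1 : inord n = ord_max :> 'I_n.+1 by apply: val_inj; rewrite /= inordK.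
rewrite E0 E1; apply: (iffP and3P) => [[/eqP ? /eqP ? /forallP H]|[-> -> H]].
  by split=> // k lkn; have := H (Ordinal lkn); rewrite /=; lia.
split=> //; apply/forallP => k; have := H k (ltn_ord k); lia.
Qed.

Lemma path_catE p q (g : motzkin_path p) (d : motzkin_path q) k : k <= p + q ->
  path_cat_fun g d (inord k) =
    if k <= p then g (inord k) else d (inord (k - p)).
Proof. by move=> lek; rewrite ffunE inordK. Qed.

Lemma path_suspE n (g : motzkin_path n) k : k <= n + 2 ->
  path_susp_fun g (inord k) =
    if (k == 0) || (k == n + 2) then 0 else (g (inord k.-1)).+1.
Proof. by move=> lek; rewrite ffunE inordK. Qed.

Lemma path_cat_subproof p q (g : motzkin_path p) (d : motzkin_path q) :
  is_motzkin (path_cat_fun g d).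
Proof.
have [g0 gp gS] := is_motzkinP _ (valP g).
have [d0 dq dS] := is_motzkinP _ (valP d).
rewrite /= in g0 gp gS d0 dq dS.
apply/is_motzkinP; split; first by rewrite path_catE ?g0 //.
- rewrite path_catE // addKn; case: ifP => // le; rewrite -[RHS]gp.
  by have -> : p + q = p by lia.
- move=> k lk; rewrite !path_catE; try lia.
  case: (ltngtP k p) => [lkp|lpk|ekp].
  + exact: gS.
  + rewrite subSn ?(ltnW lpk) //; apply: dS; lia.
  + by rewrite ekp gp subSn // subnn; have /dS : 0 < q by [lia]; rewrite d0.
Qed.

Lemma path_susp_subproof n (g : motzkin_path n) : is_motzkin (path_susp_fun g).
Proof.
have [g0 gn gS] := is_motzkinP _ (valP g).
rewrite /= in g0 gn gS.
apply/is_motzkinP; split; rewrite ?path_suspE ?eqxx ?orbT //.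
move=> k lk; rewrite !path_suspE; try lia.
case: k lk => [|k] lk /=.
  by rewrite g0; case: ifP; lia.
have -> /= : (k.+1 == n + 2) = false by lia.
case: (eqVneq (k.+2) (n + 2)) => [e|ne].
  by have -> : k = n by [lia]; rewrite gn.
have /gS : k < n by lia.
lia.
Qed.

Definition path_cat p q g d : motzkin_path (p + q) :=
  MotzkinPath (@path_cat_subproof p q g d).

Definition path_susp n g : motzkin_path (n + 2) :=
  MotzkinPath (@path_susp_subproof n g).

Lemma path_one_subproof : is_motzkin [ffun _ : 'I_1 => 0].
Proof. by apply/is_motzkinP; split; rewrite ?ffunE. Qed.

Definition path_one : motzkin_path 0 := MotzkinPath path_one_subproof.

Definition motzkin := {n : nat & motzkin_path n}.

HB.instance Definition _ := Choice.on motzkin.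

Definition motzkin_mul (x y : motzkin) : motzkin :=
  existT motzkin_path _ (path_cat (tagged x) (tagged y)).

Definition motzkin_one : motzkin := existT motzkin_path 0 path_one.

Definition motzkin_susp (x : motzkin) : motzkin :=
  existT motzkin_path _ (path_susp (tagged x)).

Lemma motzkin_eq (x y : motzkin) : tag x = tag y ->
  (forall k, k <= tag x -> tagged x (inord k) = tagged y (inord k)) -> x = y.
Proof.
case: x y => [n g] [m d] /= e; case: m / e d => d H.
congr existT; apply/val_inj/ffunP => i.
by have := H i (ltn_ord i); rewrite inord_val.
Qed.

Lemma motzkin_mulA : associative motzkin_mul.
Proof.
move=> x y z; apply: motzkin_eq => [|k]; first exact: addnA.
rewrite /= => lek; do ! (rewrite path_catE; last by lia).
case: (leqP k (tag x)) => l1.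
  rewrite ifT; last lia.
  by rewrite path_catE ?ifT //; lia.
case: (leqP (k - tag x) (tag y)) => l2.
  rewrite [RHS]ifT; last lia.
  by rewrite path_catE ?ifF //; lia.
rewrite [RHS]ifF; last lia.
by congr (tagged z (inord _)); lia.
Qed.

Lemma motzkin_mul1 : left_id motzkin_one motzkin_mul.
Proof.
move=> x; apply: motzkin_eq => //= k lek; rewrite path_catE // subn0.
case: leqP => //; rewrite leqn0 => /eqP ->; rewrite ffunE.
by have [] := is_motzkinP _ (valP (tagged x)).
Qed.

Lemma motzkin_mulr1 : right_id motzkin_one motzkin_mul.
Proof.
move=> x; apply: motzkin_eq => /= [|k lek]; first exact: addn0.
by rewrite path_catE // ifT // -[tag x]addn0.
Qed.

HB.instance Definition _ :=
  isMonoid.Build motzkin motzkin_mulA motzkin_mul1 motzkin_mulr1.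
HB.instance Definition _ := isGraded.Build motzkin
  (degree := (fun x : motzkin => tag x)) erefl (fun x y => erefl).
HB.instance Definition _ := hasSuspension.Build motzkin
  (suspension := motzkin_susp) (fun x => erefl).

(* The pair (i, j) stands for the segment [i, j]. *)
Notation segment := (nat * nat)%type.

Definition in_segment k (A : segment) : bool := A.1 <= k <= A.2.

Definition in_column k (A : segment) : bool := A.1 <= k < A.2.

Definition segment_over n (A : segment) : bool := [&& 1 <= A.1, A.1 <= A.2 & A.2 <= n].

(* As there is no segment over [1, 0], R_0 consists of the empty multisegment. *)
Definition in_R n (M : seq segment) : bool :=
  all (segment_over n) M &&
  all (fun k => count (in_segment k) M == n + 1) (iota 1 n).

(* In R_n the subtraction is never truncated: a segment containing the column k
   contains the point k. *)
Definition cuts n (M : seq segment) k : nat := n + 1 - count (in_column k) M.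

Definition at_most_one_cut n (M : seq segment) : bool :=
  all (fun k => cuts n M k <= 1) (iota 1 n.-1).

(* A union of two nonempty sets of integers is an interval if it contains every
   integer between its minimum and its maximum. *)
Definition union_is_segment (A B : segment) : bool :=
  all (fun k => in_segment k A || in_segment k B)
      (index_iota (minn A.1 B.1) (maxn A.2 B.2).+1).

Definition linked (A B : segment) : bool :=
  [&& A.1 < B.1, A.2 < B.2 & union_is_segment A B].

Definition quasi_linked (A B : segment) : bool :=
  linked A B || (A.2 + 1 == B.1 - 1).

Definition linked3 (A B C : segment) : bool :=
  [&& linked A B, linked B C & quasi_linked A C].

Definition excessive (M : seq segment) : bool :=
  all (fun A => all (fun B => all (fun C => ~~ linked3 A B C) M) M) M.

Definition sorted_starts p (s : seq segment) : seq nat :=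
  sort geq [seq A.1 | A <- s & A.2 == p].

Definition sorted_ends (s : seq segment) : seq nat :=
  sort leq [seq A.2 | A <- s & A.1 == 1].

Definition bridges p q (M N : seq segment) : seq segment :=
  zip (sorted_starts p (M ++ nseq q (1, p)))
      (sorted_ends (N ++ nseq p (1, q))).

Definition concat_segments p q (M N : seq segment) : seq segment :=
  [seq A <- M | A.2 < p] ++
  [seq (A.1 + p, A.2 + p) | A <- N & 1 < A.1] ++
  [seq (A.1, A.2 + p) | A <- bridges p q M N].

(* Only meaningful for M in R_p and N in R_q. *)
Definition multisegment_cat p q (M N : {mset segment}) : {mset segment} :=
  if p == 0 then N else if q == 0 then M else seq_mset (concat_segments p q M N).

Definition susp_segment n (A : segment) : segment :=
  (if A.1 == 1 then 1 else A.1 + 1, if A.2 == n then n + 2 else A.2 + 1).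

Definition susp_segments n (M : seq segment) : seq segment :=
  if n == 0 then [:: (1, 1); (2, 2); (1, 2); (1, 2)]
  else [seq susp_segment n A | A <- M] ++
       [:: (1, 1); (2, n + 2); (1, n + 1); (n + 2, n + 2)].

Definition multisegment_susp n (M : {mset segment}) : {mset segment} :=
  seq_mset (susp_segments n M).

Lemma in_R_perm n s t : perm_eq s t -> in_R n s = in_R n t.
Proof.
move=> e; rewrite /in_R (perm_all _ e); congr (_ && _).
by apply: eq_all => k; rewrite (permP e).
Qed.

Lemma at_most_one_cut_perm n s t :
  perm_eq s t -> at_most_one_cut n s = at_most_one_cut n t.
Proof. by move=> e; apply: eq_all => k; rewrite /cuts (permP e). Qed.

Lemma excessive_perm s t : perm_eq s t -> excessive s = excessive t.
Proof.
move=> e; rewrite /excessive (perm_all _ e); apply: eq_all => A.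
by rewrite (perm_all _ e); apply: eq_all => B; rewrite (perm_all _ e).
Qed.

Lemma sorted_starts_perm p s t :
  perm_eq s t -> sorted_starts p s = sorted_starts p t.
Proof.
move=> e; apply/perm_sortP; rewrite ?perm_map ?perm_filter //.
- by move=> x y; rewrite /geq /= leq_total.
- by move=> y x z /= h1 h2; apply: leq_trans h1.
- by move=> x y; rewrite /geq /= andbC -eqn_leq => /eqP.
Qed.

Lemma sorted_ends_perm s t : perm_eq s t -> sorted_ends s = sorted_ends t.
Proof.
move=> e; apply/perm_sortP; rewrite ?perm_map ?perm_filter //.
- exact: leq_total.
- exact: leq_trans.
- exact: anti_leq.
Qed.

Lemma concat_segments_perm p q s s' t t' : perm_eq s s' -> perm_eq t t' ->
  perm_eq (concat_segments p q s t) (concat_segments p q s' t').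
Proof.
move=> es et; rewrite /concat_segments /bridges.
rewrite (@sorted_starts_perm p (s ++ _) (s' ++ nseq q (1, p))) ?perm_cat2r //.
rewrite (@sorted_ends_perm (t ++ _) (t' ++ nseq p (1, q))) ?perm_cat2r //.
apply: perm_cat; first exact: perm_filter.
by rewrite perm_cat2r perm_map ?perm_filter.
Qed.

Lemma in_RP n s : reflect
  [/\ {in s, forall A : segment, [/\ 1 <= A.1, A.1 <= A.2 & A.2 <= n]} &
      forall k, 1 <= k <= n -> count (in_segment k) s = n + 1]
  (in_R n s).
Proof.
apply: (iffP andP) => -[H1 H2]; split.
- by move=> A As; apply/and3P/(allP H1 A As).
- by move=> k lk; apply/eqP/(allP H2); rewrite mem_iota; lia.
- by apply/allP => A As; apply/and3P/H1.
- by apply/allP => k; rewrite mem_iota => lk; apply/eqP/H2; lia.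
Qed.

Lemma sorted_starts_cat p q s : {in s, forall A : segment, 1 <= A.1} ->
  sorted_starts p (s ++ nseq q (1, p)) = sorted_starts p s ++ nseq q 1.
Proof.
move=> H; rewrite /sorted_starts filter_cat map_cat.
have -> : [seq A.1 | A <- nseq q (1, p) & A.2 == p] = nseq q 1.
  by rewrite filter_nseq eqxx mul1n map_nseq.
set u := [seq _ | _ <- _ & _].
apply: (@sorted_eq _ geq).
- by move=> y x z /= h1 h2; apply: leq_trans h1.
- by move=> x y; rewrite /geq /= andbC -eqn_leq => /eqP.
- by apply: sort_sorted => x y; rewrite /geq /= leq_total.
- have ge_tr : transitive geq by move=> y x z /= h1 h2; apply: leq_trans h1.
  rewrite (sorted_pairwise ge_tr) pairwise_cat -!(sorted_pairwise ge_tr).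
  apply/and3P; split.
  + apply/allrelP => x y; rewrite mem_sort mem_nseq => xu /andP[_ /eqP ->].
    by case/mapP: xu => A; rewrite mem_filter => /andP[_ /H] ? ->.
  + by apply: sort_sorted => x y; rewrite /geq /= leq_total.
  + by elim: q => //= -[|q] //= ->.
- by rewrite perm_sort perm_sym perm_cat2r perm_sort.
Qed.

Lemma sorted_ends_cat p q s : {in s, forall A : segment, A.2 <= q} ->
  sorted_ends (s ++ nseq p (1, q)) = sorted_ends s ++ nseq p q.
Proof.
move=> H; rewrite /sorted_ends filter_cat map_cat.
have -> : [seq A.2 | A <- nseq p (1, q) & A.1 == 1] = nseq p q.
  by rewrite filter_nseq eqxx mul1n map_nseq.
set u := [seq _ | _ <- _ & _].
apply: (@sorted_eq _ leq).
- exact: leq_trans.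
- exact: anti_leq.
- exact: sort_sorted leq_total _.
- rewrite (sorted_pairwise leq_trans) pairwise_cat -!(sorted_pairwise leq_trans).
  apply/and3P; split.
  + apply/allrelP => x y; rewrite mem_sort mem_nseq => xu /andP[_ /eqP ->].
    by case/mapP: xu => A; rewrite mem_filter => /andP[_ /H] ? ->.
  + exact: sort_sorted leq_total _.
  + by elim: p => //= -[|p] //= ->; rewrite leqnn.
- by rewrite perm_sort perm_sym perm_cat2r perm_sort.
Qed.

Lemma size_sorted_starts p s : 0 < p -> in_R p s ->
  size (sorted_starts p s) = p + 1.
Proof.
move=> p0 /in_RP[Hb Hc]; rewrite size_sort size_map size_filter -(Hc p) ?p0 ?leqnn //.
by apply: eq_in_count => A /Hb[]; rewrite /in_segment /=; lia.
Qed.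

Lemma size_sorted_ends q s : 0 < q -> in_R q s ->
  size (sorted_ends s) = q + 1.
Proof.
move=> q0 /in_RP[Hb Hc]; rewrite size_sort size_map size_filter -(Hc 1) ?q0 //.
by apply: eq_in_count => A /Hb[]; rewrite /in_segment /=; lia.
Qed.

Lemma bridgesE p q s t : in_R p s -> in_R q t ->
  bridges p q s t =
    zip (sorted_starts p s ++ nseq q 1) (sorted_ends t ++ nseq p q).
Proof.
move=> /in_RP[Hs _] /in_RP[Ht _]; rewrite /bridges sorted_starts_cat.
  by rewrite sorted_ends_cat // => A /Ht[].
by move=> A /Hs[].
Qed.

Lemma count_split (T : Type) (b a : pred T) s :
  count a s = count (predI a b) s + count (predI a (predC b)) s.
Proof. by elim: s => //= x s ->; case: (a x) (b x) => -[] //=; lia. Qed.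

Lemma count_zip_fst (a : pred nat) s t : size s <= size t ->
  count (fun x : segment => a x.1) (zip s t) = count a s.
Proof. by move=> le; rewrite -{2}(unzip1_zip le) count_map. Qed.

Lemma count_zip_snd (a : pred nat) s t : size t <= size s ->
  count (fun x : segment => a x.2) (zip s t) = count a t.
Proof. by move=> le; rewrite -{2}(unzip2_zip le) count_map. Qed.

Lemma mem_zip (s t : seq nat) (A : segment) : A \in zip s t -> A.1 \in s /\ A.2 \in t.
Proof.
elim: s t => [|x s IH] [|y t] //=; rewrite !inE => /orP[/eqP -> /=|/IH[-> ->]].
  by rewrite !eqxx.
by rewrite !orbT.
Qed.

Lemma mem_sorted_starts p s i : (i \in sorted_starts p s) = ((i, p) \in s).
Proof.
rewrite mem_sort; apply/mapP/idP => [[[a b]]|h].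
  by rewrite mem_filter /= => /andP[/eqP -> ?] ->.
by exists (i, p) => //; rewrite mem_filter /= eqxx.
Qed.

Lemma mem_sorted_ends s j : (j \in sorted_ends s) = ((1, j) \in s).
Proof.
rewrite mem_sort; apply/mapP/idP => [[[a b]]|h].
  by rewrite mem_filter /= => /andP[/eqP -> ?] ->.
by exists (1, j) => //; rewrite mem_filter.
Qed.

Lemma count_sorted_starts a p s :
  count a (sorted_starts p s) = count (fun A : segment => a A.1 && (A.2 == p)) s.
Proof. by rewrite count_sort count_map count_filter. Qed.

Lemma count_sorted_ends a s :
  count a (sorted_ends s) = count (fun A : segment => a A.2 && (A.1 == 1)) s.
Proof. by rewrite count_sort count_map count_filter. Qed.

Section Concat.

Variables (p q : nat) (s t : seq segment).
Hypotheses (p0 : 0 < p) (q0 : 0 < q) (Rs : in_R p s) (Rt : in_R q t).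

Let sizeS : size (sorted_starts p s ++ nseq q 1) = p + q + 1.
Proof. by rewrite size_cat size_sorted_starts // size_nseq; lia. Qed.

Let sizeT : size (sorted_ends t ++ nseq p q) = p + q + 1.
Proof. by rewrite size_cat (size_sorted_ends q0 Rt) size_nseq; lia. Qed.

Lemma mem_bridges (A : segment) : A \in bridges p q s t ->
  [/\ 1 <= A.1 <= p, 1 <= A.2 <= q,
      1 < A.1 -> (A.1, p) \in s & A.2 < q -> (1, A.2) \in t].
Proof.
have /in_RP[Hs _] := Rs; have /in_RP[Ht _] := Rt.
rewrite bridgesE // => /mem_zip[]; rewrite !mem_cat !mem_nseq mem_sorted_starts.
rewrite mem_sorted_ends => H1 H2; split.
- by case/orP: H1 => [/Hs[] /=|]; lia.
- by case/orP: H2 => [/Ht[] /=|]; lia.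
- by case/orP: H1 => //; lia.
- by case/orP: H2 => //; lia.
Qed.

Lemma bridges_unlinked (A B : segment) : A \in bridges p q s t -> B \in bridges p q s t ->
  B.1 <= A.1 \/ B.2 <= A.2.
Proof.
rewrite /bridges; set u := sorted_starts _ _; set v := sorted_ends _.
have su : sorted geq u by apply: sort_sorted => x y; rewrite /geq /= leq_total.
have sv : sorted leq v by apply: sort_sorted leq_total _.
have suv : size u = size v.
  rewrite /u /v; have /in_RP[Hs _] := Rs; have /in_RP[Ht _] := Rt.
  rewrite sorted_starts_cat; last by move=> ? /Hs[].
  by rewrite sorted_ends_cat ?sizeS ?sizeT // => ? /Ht[].
have szz : size (zip u v) = size u by rewrite size_zip suv minnn.
move=> /(nthP (0, 0))[i li <-] /(nthP (0, 0))[j lj <-].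
rewrite szz in li lj; rewrite !nth_zip //=.
have ge_tr : transitive geq by move=> y x z /= h1 h2; apply: leq_trans h1.
case: (leqP i j) => [lij|/ltnW lji].
  have := sorted_leq_nth ge_tr leqnn 0 su i j li lj lij; rewrite /geq /=; by left.
have := sorted_leq_nth leq_trans leqnn 0 sv j i; rewrite !inE -suv => /(_ lj li lji).
by right.
Qed.

Lemma mem_concat (A : segment) : A \in concat_segments p q s t ->
  [\/ A \in s /\ A.2 < p,
      exists B : segment, [/\ B \in t, 1 < B.1 & A = (B.1 + p, B.2 + p)] |
      exists B : segment, B \in bridges p q s t /\ A = (B.1, B.2 + p)].
Proof.
rewrite !mem_cat mem_filter => /or3P[/andP[? ?]|/mapP[B]|/mapP[B ? ->]].
- by apply: Or31.
- by rewrite mem_filter => /andP[? ?] ->; apply: Or32; exists B.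
- by apply: Or33; exists B.
Qed.

Lemma count_concat_left (a b : pred segment) k :
  {in s, forall A, A.2 < p -> b A = a A} ->
  {in t, forall A : segment, ~~ b (A.1 + p, A.2 + p)} ->
  {in bridges p q s t, forall A : segment, b (A.1, A.2 + p) = (A.1 <= k)} ->
  {in s, forall A, A.2 = p -> a A = (A.1 <= k)} -> 1 <= k ->
  count b (concat_segments p q s t) = count a s + q.
Proof.
have /in_RP[Hs _] := Rs.
move=> H1 H2 H3 H4 k1; rewrite /concat_segments !count_cat !count_map.
rewrite (@eq_in_count _ _ xpred0 [seq _ <- t | _]); last first.
  by move=> A; rewrite mem_filter => /andP[_ /H2 /negbTE].
rewrite count_pred0 add0n (eq_in_count H3) bridgesE //.
rewrite (@count_zip_fst (fun i => i <= k)) ?sizeS ?sizeT //.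
rewrite count_cat count_nseq k1 mul1n addnA; congr (_ + _).
rewrite count_sorted_starts count_filter.
rewrite (count_split (fun A : segment => A.2 < p) a); congr (_ + _).
  by apply: eq_in_count => A As /=; case: ltnP; rewrite ?andbF // => /H1 -> //.
apply: eq_in_count => A As /=; have [_ _] := Hs A As; rewrite -leqNgt.
case: (ltngtP A.2 p) => //= [_|e]; first by rewrite !andbF.
by rewrite !andbT H4.
Qed.

Lemma count_concat_right (a b : pred segment) k :
  {in t, forall A : segment, 1 < A.1 -> b (A.1 + p, A.2 + p) = a A} ->
  {in s, forall A : segment, A.2 < p -> ~~ b A} ->
  {in bridges p q s t, forall A : segment, b (A.1, A.2 + p) = (k <= A.2)} ->
  {in t, forall A, A.1 = 1 -> a A = (k <= A.2)} -> k <= q ->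
  count b (concat_segments p q s t) = count a t + p.
Proof.
have /in_RP[Ht _] := Rt.
move=> H1 H2 H3 H4 kq; rewrite /concat_segments !count_cat !count_map.
rewrite (@eq_in_count _ _ xpred0 [seq _ <- s | _]); last first.
  by move=> A; rewrite mem_filter => /andP[Ap As]; apply/negbTE/H2.
rewrite count_pred0 add0n (eq_in_count H3) bridgesE //.
rewrite (@count_zip_snd (fun i => k <= i)) ?sizeS ?sizeT //.
rewrite count_cat count_nseq kq mul1n addnA; congr (_ + _).
rewrite count_sorted_ends count_filter.
rewrite (count_split (fun A : segment => 1 < A.1) a); congr (_ + _).
  by apply: eq_in_count => A As /=; case: ltnP; rewrite ?andbF ?andbT // => /H1 -> //.
apply: eq_in_count => A As /=; have [+ _ _] := Ht A As; rewrite -leqNgt.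
case: (ltngtP 1 A.1) => //= [_|e] _; first by rewrite !andbF.
by rewrite !andbT H4.
Qed.

Lemma in_R_concat : in_R (p + q) (concat_segments p q s t).
Proof.
have /in_RP[Hs Hs'] := Rs; have /in_RP[Ht Ht'] := Rt.
apply/in_RP; split.
  move=> A /mem_concat[[/Hs[? ? ?] ?]|[B [/Ht[? ? ?] ? ->]]|[B [/mem_bridges[]]]] /=.
  - by split; lia.
  - by split; lia.
  - by move=> ? ? _ _ -> /=; split; lia.
move=> k kpq; case: (leqP k p) => kp.
  rewrite (@count_concat_left (in_segment k) _ k) ?Hs' //; try lia.
  - by move=> A /Ht[]; rewrite /in_segment /=; lia.
  - by move=> A /mem_bridges[]; rewrite /in_segment /=; lia.
  - by move=> A /Hs[]; rewrite /in_segment /=; lia.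
rewrite (@count_concat_right (in_segment (k - p)) _ (k - p)) ?Ht' //; try lia.
- by move=> A /Ht[]; rewrite /in_segment /=; lia.
- by move=> A /Hs[]; rewrite /in_segment /=; lia.
- by move=> A /mem_bridges[]; rewrite /in_segment /=; lia.
- by move=> A /Ht[]; rewrite /in_segment /=; lia.
Qed.

Lemma at_most_one_cut_concat : at_most_one_cut p s -> at_most_one_cut q t ->
  at_most_one_cut (p + q) (concat_segments p q s t).
Proof.
have /in_RP[Hs _] := Rs; have /in_RP[Ht _] := Rt.
move=> /allP Cs /allP Ct; apply/allP => k; rewrite mem_iota /cuts => lk.
case: (ltngtP k p) => kp.
- rewrite (@count_concat_left (in_column k) _ k); try lia.
  + by have := Cs k; rewrite mem_iota /cuts => /(_ ltac:(lia)); lia.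
  + by [].
  + by move=> A /Ht[]; rewrite /in_column /=; lia.
  + by move=> A /mem_bridges[]; rewrite /in_column /=; lia.
  + by move=> A /Hs[]; rewrite /in_column /=; lia.
- rewrite (@count_concat_right (in_column (k - p)) _ (k - p).+1); try lia.
  + by have := Ct (k - p); rewrite mem_iota /cuts => /(_ ltac:(lia)); lia.
  + by move=> A /Ht[]; rewrite /in_column /=; lia.
  + by move=> A /Hs[]; rewrite /in_column /=; lia.
  + by move=> A /mem_bridges[]; rewrite /in_column /=; lia.
  + by move=> A /Ht[]; rewrite /in_column /=; lia.
- rewrite /concat_segments !count_cat [count _ [seq _ | _ <- bridges _ _ _ _]]count_map.
  rewrite (@eq_in_count _ _ xpredT (bridges _ _ _ _)).
    by rewrite count_predT bridgesE // size_zip sizeS sizeT; lia.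
  by move=> A /mem_bridges[]; rewrite /in_column /=; lia.
Qed.

End Concat.

Lemma linkedE n m A B : segment_over n A -> segment_over m B ->
  linked A B = [&& A.1 < B.1, A.2 < B.2 & B.1 <= A.2 + 1].
Proof.
move=> /and3P[? ? ?] /and3P[? ? ?]; rewrite /linked.
case: (ltnP A.1 B.1) => //= lAB; case: (ltnP A.2 B.2) => //= lAB2.
apply/allP/idP => [H|H k].
  apply: contraT => h; have := H (A.2 + 1).
  by rewrite mem_index_iota /in_segment; lia.
by rewrite mem_index_iota /in_segment; lia.
Qed.

Lemma linked3E n m l A B C :
  segment_over n A -> segment_over m B -> segment_over l C ->
  linked3 A B C =
  [&& A.1 < B.1, A.2 < B.2, B.1 <= A.2 + 1, B.1 < C.1, B.2 < C.2,
      C.1 <= B.2 + 1 & C.1 <= A.2 + 2].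
Proof.
move=> hA hB hC; rewrite /linked3 /quasi_linked (linkedE hA hB).
rewrite (linkedE hB hC) (linkedE hA hC).
move: hA hB hC; rewrite /segment_over; lia.
Qed.

Lemma excessiveP n s : in_R n s -> reflect
  (forall A B C : segment, A \in s -> B \in s -> C \in s ->
     [&& A.1 < B.1, A.2 < B.2, B.1 <= A.2 + 1, B.1 < C.1, B.2 < C.2,
         C.1 <= B.2 + 1 & C.1 <= A.2 + 2] -> False)
  (excessive s).
Proof.
move=> /andP[/allP Hs _]; apply: (iffP idP) => [H A B C As Bs Cs h|H].
  have /allP /(_ _ Bs) /allP /(_ _ Cs) := allP H A As.
  by rewrite (linked3E (Hs _ As) (Hs _ Bs) (Hs _ Cs)) h.
apply/allP => A As; apply/allP => B Bs; apply/allP => C Cs.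
by rewrite (linked3E (Hs _ As) (Hs _ Bs) (Hs _ Cs)); apply/negP; apply: H.
Qed.

Lemma excessive_concat p q s t : 0 < p -> 0 < q -> in_R p s -> in_R q t ->
  excessive s -> excessive t -> excessive (concat_segments p q s t).
Proof.
move=> p0 q0 Rs Rt /(excessiveP Rs) Es /(excessiveP Rt) Et.
apply/(excessiveP (in_R_concat p0 q0 Rs Rt)) => /= A B C mA mB mC.
have /in_RP[Hs _] := Rs; have /in_RP[Ht _] := Rt.
have U := bridges_unlinked p0 q0 Rs Rt.
have MB := mem_bridges p0 q0 Rs Rt.
move=> /and5P[h1 h2 h3 h4 /and3P[h5 h6 h7]].
have MA (X : segment) : X \in s -> X.2 < p -> [/\ 1 <= X.1, X.1 <= X.2 & X.2 < p].
  by move=> /Hs[].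
have MT (X : segment) : X \in t -> 1 < X.1 -> [/\ 1 < X.1, X.1 <= X.2 & X.2 <= q].
  by move=> /Ht[].
have MB' (X : segment) : X \in bridges p q s t -> [/\ 1 <= X.1, X.1 <= p, 1 <= X.2 & X.2 <= q].
  by case/MB => /andP[? ?] /andP[? ?].
case: (mem_concat mA) => [[As Ap]|[A' [As Ap eA]]|[A' [As eA]]];
case: (mem_concat mB) => [[Bs Bp]|[B' [Bs Bp eB]]|[B' [Bs eB]]];
case: (mem_concat mC) => [[Cs Cp]|[C' [Cs Cp eC]]|[C' [Cs eC]]];
rewrite ?eA ?eB ?eC /= in h1 h2 h3 h4 h5 h6 h7;
try clear eA; try clear eB; try clear eC.
1: by apply: (Es A B C); rewrite // h1 h2 h3 h4 h5 h6 h7.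
2: { have [/andP[C1 C2] _ Cin _] := MB _ Cs.
  have /Cin Cs' : 1 < C'.1.
    have [A1 _ _] := Hs _ As; clear -h1 h4 A1. lia.
  by apply: (Es A B (C'.1, p) As Bs Cs'); rewrite /= h1 h2 h3 h4 Bp h6 h7. }
12: { apply: (Et A' B' C' As Bs Cs); clear -h1 h2 h3 h4 h5 h6 h7; lia. }
20: { have [_ /andP[A1 A2] _ Ain] := MB _ As; have [_ _ Bq] := Ht _ Bs.
  have /Ain As' : A'.2 < q by clear -h2 Bq; lia.
  by apply: (Et (1, A'.2) B' C' As' Bs Cs);
    clear -h1 h2 h3 h4 h5 h6 h7 Bq Bp; rewrite /=; lia. }
all: try (have UAB := U _ _ As Bs); try (have UAC := U _ _ As Cs);
     try (have UBC := U _ _ Bs Cs).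
all: try have [? ? ?] := MA _ As Ap; try have [? ? ?] := MA _ Bs Bp;
     try have [? ? ?] := MA _ Cs Cp; try have [? ? ?] := MT _ As Ap;
     try have [? ? ?] := MT _ Bs Bp; try have [? ? ?] := MT _ Cs Cp.
all: try have [? ? ? ?] := MB' _ As; try have [? ? ? ?] := MB' _ Bs;
     try have [? ? ? ?] := MB' _ Cs.
all: clear Es Et Hs Ht U MA MT MB MB' mA mB mC As Bs Cs Rs Rt.
all: lia.
Qed.

Lemma count_susp (a b : pred segment) n s : {in s, forall A : segment, b (susp_segment n A) = a A} ->
  0 < n -> count b (susp_segments n s) =
    count a s + count b [:: (1, 1); (2, n + 2); (1, n + 1); (n + 2, n + 2)].
Proof.
move=> H n0; rewrite /susp_segments ifF; last by lia.
by rewrite count_cat count_map (eq_in_count H).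
Qed.

Lemma in_R_susp n s : in_R n s -> in_R (n + 2) (susp_segments n s).
Proof.
case: (posnP n) => [-> _|n0 /in_RP[Hs Hs']] //.
apply/in_RP; split.
  move=> /= A; rewrite /susp_segments ifF; last by lia.
  rewrite mem_cat !inE => /orP[/mapP[/= B /Hs[? ? ?] ->]|].
    by rewrite /susp_segment /=; do 2 case: eqP => ?; split; lia.
  by case/or4P => /eqP -> /=; split; lia.
move=> k kn; have Hk : 1 <= minn (maxn k.-1 1) n <= n by lia.
rewrite (@count_susp (in_segment (minn (maxn k.-1 1) n))) // ?Hs' //.
  by rewrite /in_segment /=; lia.
by move=> A /Hs[]; rewrite /in_segment /susp_segment /=;
    do 2 case: eqP => ?; lia.
Qed.

Lemma at_most_one_cut_susp n s : in_R n s -> at_most_one_cut n s ->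
  at_most_one_cut (n + 2) (susp_segments n s).
Proof.
case: (posnP n) => [-> _|n0 /in_RP[Hs Hs'] /allP Cs] //.
apply/allP => k; rewrite mem_iota /cuts => lk.
have [k1|kn|lk'] : [\/ k = 1, k = n.+1 | 1 < k < n.+1].
- by case: (ltngtP k 1) => ?; [lia|case: (ltngtP k n.+1) => ?;
    [apply: Or33; lia|lia|apply: Or32]|apply: Or31].
- rewrite (@count_susp (in_segment 1)) // ?Hs' //=; first by rewrite /in_column /=; lia.
  by move=> A /Hs[]; rewrite /in_segment /in_column /susp_segment /=;
    do 2 case: eqP => ?; lia.
- rewrite (@count_susp (in_segment n)) // ?Hs' //=; try lia.
    by rewrite /in_column /=; lia.
  by move=> A /Hs[]; rewrite /in_segment /in_column /susp_segment /=;
    do 2 case: eqP => ?; lia.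
- rewrite (@count_susp (in_column k.-1)) //.
    have := Cs k.-1; rewrite mem_iota /cuts => /(_ ltac:(lia)).
    by rewrite /in_column /=; lia.
  by move=> A /Hs[]; rewrite /in_column /susp_segment /=;
    do 2 case: eqP => ?; lia.
Qed.

Lemma excessive_susp n s : in_R n s -> excessive s -> excessive (susp_segments n s).
Proof.
case: (posnP n) => [-> _|n0 Rs /(excessiveP Rs) Es] //.
have /in_RP[Hs _] := Rs.
apply/(excessiveP (in_R_susp Rs)) => /= A B C.
have M (X : segment) : X \in susp_segments n s ->
  (exists Y : segment, [/\ Y \in s, 1 <= Y.1 <= Y.2, Y.2 <= n,
     X.1 = (if Y.1 == 1 then 1 else Y.1 + 1)
     & X.2 = (if Y.2 == n then n + 2 else Y.2 + 1)])
  \/ [\/ X.1 = 1 /\ X.2 = 1, X.1 = 2 /\ X.2 = n + 2,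
         X.1 = 1 /\ X.2 = n + 1 | X.1 = n + 2 /\ X.2 = n + 2].
  rewrite /susp_segments ifF; last by lia.
  rewrite mem_cat !inE => /orP[/mapP[Y mY ->]|].
    left; exists Y; have [? ? ?] := Hs Y mY; split=> //; first lia.
  by case/or4P => /eqP -> /=; right;
    [apply: Or41|apply: Or42|apply: Or43|apply: Or44].
move=> /M mA /M mB /M mC /and5P[h1 h2 h3 h4 /and3P[h5 h6 h7]].
have c0 : C.1 <= C.2 <= n + 2.
  case: mC => [[C' [_ c1 c2 -> ->]]|].
    by clear -c1 c2; do 2 case: eqP => ?; lia.
  by case=> -[-> ->]; clear; lia.
have a0 : 1 <= A.1 <= A.2.
  case: mA => [[A' [_ a1 a2 -> ->]]|].
    by clear -a1 a2; do 2 case: eqP => ?; lia.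
  by case=> -[-> ->]; clear; lia.
case: mB => [[B' [Bs b1 b2 b3 b4]]|mB]; last first.
  by clear M Es Rs Hs mA mC; case: mB => -[e1 e2]; rewrite e1 e2 in h1 h2 h3 h4 h5 h6 h7;
    lia.
case: mA => [[A' [As a1 a2 a3 a4]]|mA]; last first.
  clear M Es Rs Hs mC; move: b3 b4; do 2 case: eqP => ?;
  by case: mA => -[e1 e2]; lia.
case: mC => [[C' [Cs c1 c2 c3 c4]]|mC]; last first.
  clear M Es Rs Hs; move: b3 b4; do 2 case: eqP => ?;
  by case: mC => -[e1 e2]; lia.
apply: (Es A' B' C' As Bs Cs); clear M Es Rs Hs As Bs Cs.
move: a3 a4 b3 b4 c3 c4; do 6 case: eqP => ?; lia.
Qed.

Lemma filter_zip_snd (a : pred nat) X Y1 Y2 : all a Y1 -> all (predC a) Y2 ->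
  size X = size Y1 + size Y2 ->
  [seq x : segment <- zip X (Y1 ++ Y2) | a x.2] = zip (take (size Y1) X) Y1 /\
  [seq x : segment <- zip X (Y1 ++ Y2) | ~~ a x.2] = zip (drop (size Y1) X) Y2.
Proof.
move=> /allP a1 /allP a2 sX.
have sz : size (take (size Y1) X) = size Y1.
  by rewrite size_take sX; case: ltnP; lia.
rewrite -[X in zip X (Y1 ++ Y2)](cat_take_drop (size Y1)) zip_cat // !filter_cat; split.
  rewrite -[RHS]cats0; congr (_ ++ _).
    by apply/all_filterP/allP => x /mem_zip[_ /a1].
  by apply/eqP; rewrite -[_ == _]negbK -has_filter -all_predC; apply/allP => x /mem_zip[_ /a2].
rewrite -[RHS]cat0s; congr (_ ++ _).
  apply/eqP; rewrite -[_ == _]negbK -has_filter -all_predC; apply/allP => x /mem_zip[_ /a1].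
  by rewrite /= negbK.
by apply/all_filterP/allP => x /mem_zip[_ /a2].
Qed.

Lemma filter_zip_fst (a : pred nat) X1 X2 Y : all a X1 -> all (predC a) X2 ->
  size Y = size X1 + size X2 ->
  [seq x : segment <- zip (X1 ++ X2) Y | a x.1] = zip X1 (take (size X1) Y) /\
  [seq x : segment <- zip (X1 ++ X2) Y | ~~ a x.1] = zip X2 (drop (size X1) Y).
Proof.
move=> /allP a1 /allP a2 sX.
have sz : size (take (size X1) Y) = size X1.
  by rewrite size_take sX; case: ltnP; lia.
rewrite -[X in zip (X1 ++ X2) X](cat_take_drop (size X1)) zip_cat // !filter_cat; split.
  rewrite -[RHS]cats0; congr (_ ++ _).
    by apply/all_filterP/allP => x /mem_zip[/a1].
  by apply/eqP; rewrite -[_ == _]negbK -has_filter -all_predC; apply/allP => x /mem_zip[/a2].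
rewrite -[RHS]cat0s; congr (_ ++ _).
  apply/eqP; rewrite -[_ == _]negbK -has_filter -all_predC; apply/allP => x /mem_zip[/a1].
  by rewrite /= negbK.
by apply/all_filterP/allP => x /mem_zip[/a2].
Qed.

Lemma geq_trans : transitive geq.
Proof. by move=> y x z /= h1 h2; apply: leq_trans h1. Qed.

Lemma geq_anti : antisymmetric geq.
Proof. by move=> x y; rewrite /geq /= andbC -eqn_leq => /eqP. Qed.

Lemma geq_total : total geq.
Proof. by move=> x y; rewrite /geq /= leq_total. Qed.

Lemma cat_sorted_rel (r : rel nat) s1 s2 : transitive r ->
  sorted r s1 -> sorted r s2 -> {in s1 & s2, forall x y, r x y} ->
  sorted r (s1 ++ s2).
Proof.
move=> tr; rewrite !(sorted_pairwise tr) pairwise_cat => -> -> H; rewrite !andbT.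
by apply/allrelP => x y; apply: H.
Qed.

Lemma sorted_split_max q (b : seq nat) : sorted leq b -> all (fun x => x <= q) b ->
  b = [seq x <- b | x < q] ++ nseq (count_mem q b) q.
Proof.
move=> sb /allP lb.
have E : [seq x <- b | ~~ (x < q)] = nseq (count_mem q b) q.
  have -> : [seq x <- b | ~~ (x < q)] = [seq x <- b | x == q].
    by apply: eq_in_filter => x /lb; lia.
  rewrite -size_filter; apply/all_pred1P/allP => x; rewrite mem_filter.
  by case/andP.
apply: (sorted_eq leq_trans anti_leq) => //.
  apply: (cat_sorted_rel leq_trans).
  - exact: sorted_filter leq_trans _ _ sb.
  - by elim: (count_mem q b) => //= -[|k] //= ->; rewrite leqnn.
  - by move=> x y; rewrite mem_filter mem_nseq => /andP[/ltnW ? _] /andP[_ /eqP ->].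
by rewrite -E perm_sym; apply/permPl; apply: perm_filterC.
Qed.

Lemma sorted_split_min (b : seq nat) : sorted geq b -> all (fun x => 1 <= x) b ->
  b = [seq x <- b | 1 < x] ++ nseq (count_mem 1 b) 1.
Proof.
move=> sb /allP lb.
have E : [seq x <- b | ~~ (1 < x)] = nseq (count_mem 1 b) 1.
  have -> : [seq x <- b | ~~ (1 < x)] = [seq x <- b | x == 1].
    by apply: eq_in_filter => x /lb; lia.
  rewrite -size_filter; apply/all_pred1P/allP => x; rewrite mem_filter.
  by case/andP.
apply: (sorted_eq geq_trans geq_anti) => //.
  apply: (cat_sorted_rel geq_trans).
  - exact: sorted_filter geq_trans _ _ sb.
  - by elim: (count_mem 1 b) => //= -[|k] //= ->.
  - by move=> x y; rewrite mem_filter mem_nseq => /andP[/ltnW ? _] /andP[_ /eqP ->].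
by rewrite -E perm_sym; apply/permPl; apply: perm_filterC.
Qed.

Lemma zip_map_l (f : nat -> nat) (s t : seq nat) :
  zip (map f s) t = [seq (f A.1, A.2) | A <- zip s t].
Proof. by elim: s t => [|x s IH] [|y t] //=; rewrite IH. Qed.

Lemma zip_map_r (f : nat -> nat) (s t : seq nat) :
  zip s (map f t) = [seq (A.1, f A.2) | A <- zip s t].
Proof. by elim: s t => [|x s IH] [|y t] //=; rewrite IH. Qed.

Lemma perm_of_eq (T : eqType) (x y : seq T) : x = y -> perm_eq x y.
Proof. by move=> ->. Qed.

Section ConcatAssoc.

Variables (p q r : nat) (s t u : seq segment).
Hypotheses (p0 : 0 < p) (q0 : 0 < q) (r0 : 0 < r).
Hypotheses (Rs : in_R p s) (Rt : in_R q t) (Ru : in_R r u).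

Let a := sorted_starts p s ++ nseq q 1.
Let b := [seq x <- sorted_ends t | x < q].
Let d := [seq x <- sorted_starts q t | 1 < x].
Let e := sorted_ends u ++ nseq q r.
Let c := count_mem (1, q) t.
Let m := size b.

Let ends_t : sorted_ends t = b ++ nseq c q.
Proof.
rewrite {1}(@sorted_split_max q (sorted_ends t)).
- congr (_ ++ nseq _ _); rewrite count_sorted_ends; apply: eq_count => -[i j].
  by rewrite /= xpair_eqE andbC.
- exact: sort_sorted leq_total _.
- by apply/allP => j; rewrite mem_sorted_ends; have /in_RP[H _] := Rt => /H[].
Qed.

Let starts_t : sorted_starts q t = d ++ nseq c 1.
Proof.
rewrite {1}(@sorted_split_min (sorted_starts q t)).
- congr (_ ++ nseq _ _); rewrite count_sorted_starts; apply: eq_count => -[i j].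
  by rewrite /= xpair_eqE.
- exact: sort_sorted geq_total _.
- by apply/allP => j; rewrite mem_sorted_starts; have /in_RP[H _] := Rt => /H[].
Qed.

Let size_d : size d = m.
Proof.
have := size_sorted_starts q0 Rt; have := size_sorted_ends q0 Rt.
by rewrite ends_t starts_t !size_cat !size_nseq -/m; lia.
Qed.

Let size_m : m + c = q + 1.
Proof.
by have := size_sorted_ends q0 Rt; rewrite ends_t size_cat size_nseq.
Qed.

Let size_a : size a = p + q + 1.
Proof. by rewrite size_cat (size_sorted_starts p0 Rs) size_nseq; lia. Qed.

Let size_e : size e = q + r + 1.
Proof. by rewrite size_cat (size_sorted_ends r0 Ru) size_nseq; lia. Qed.

Let all_b : all (fun x => x < q) b.
Proof. exact: filter_all. Qed.

Let all_d : all (fun x => 1 < x) d.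
Proof. exact: filter_all. Qed.

Let st_bridges : bridges p q s t = zip a (b ++ nseq (c + p) q).
Proof. by rewrite bridgesE // ends_t -catA nseqD. Qed.

Let tu_bridges : bridges q r t u = zip (d ++ nseq (c + r) 1) e.
Proof. by rewrite bridgesE // starts_t -catA nseqD. Qed.

Let st_split :
  [seq x <- bridges p q s t | x.2 < q] = zip (take m a) b /\
  [seq x <- bridges p q s t | ~~ (x.2 < q)] = zip (drop m a) (nseq (c + p) q).
Proof.
rewrite st_bridges; apply: (@filter_zip_snd (fun x => x < q)) => //.
  by apply/allP => x; rewrite mem_nseq /= => /andP[_ /eqP ->]; rewrite ltnn.
by rewrite size_a size_nseq -/m; lia.
Qed.

Let tu_split :
  [seq x <- bridges q r t u | 1 < x.1] = zip d (take m e) /\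
  [seq x <- bridges q r t u | ~~ (1 < x.1)] = zip (nseq (c + r) 1) (drop m e).
Proof.
rewrite tu_bridges -size_d; apply: (@filter_zip_fst (fun x => 1 < x)) => //.
  by apply/allP => x; rewrite mem_nseq /= => /andP[_ /eqP ->].
by rewrite size_e size_nseq size_d; lia.
Qed.

Let L := concat_segments p q s t.
Let K := concat_segments q r t u.

Let starts_L : sorted_starts (p + q) L = [seq x + p | x <- d] ++ drop m a.
Proof.
have /in_RP[Hs _] := Rs; have /in_RP[Ht _] := Rt.
have sa : sorted geq a.
  rewrite /a -sorted_starts_cat; first exact: sort_sorted geq_total _.
  by move=> x /Hs[].
have ap : {in a, forall x, x <= p}.
  move=> x; rewrite mem_cat mem_sorted_starts mem_nseq => /orP[/Hs[] //|].
  by move=> /andP[_ /eqP ->].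
apply: (sorted_eq geq_trans geq_anti).
- exact: sort_sorted geq_total _.
- apply: (cat_sorted_rel geq_trans).
  + rewrite sorted_map; apply: (@sub_sorted _ geq).
      by move=> x y; rewrite /= leq_add2r.
    by apply: (sorted_filter geq_trans); apply: sort_sorted geq_total _.
  + exact: drop_sorted.
  + move=> x y /mapP[z]; rewrite mem_filter => /andP[z1 _] -> /mem_drop /ap.
    by rewrite /=; lia.
rewrite perm_sort /L /concat_segments !filter_cat !map_cat.
have -> : [seq A <- [seq A <- s | A.2 < p] | A.2 == p + q] = [::].
  apply/eqP; rewrite -[_ == _]negbK -has_filter -all_predC; apply/allP => A.
  by rewrite mem_filter /=; lia.
rewrite cat0s; apply: perm_cat.
  rewrite filter_map -map_comp (eq_map (_ : _ =1 (fun x => x + p) \o fst)) //.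
  rewrite map_comp perm_map //.
  rewrite perm_sym /d.
  apply: (@perm_trans _ [seq x <- [seq A.1 | A <- t & A.2 == q] | 1 < x]).
    by apply: perm_filter; rewrite perm_sort.
  rewrite filter_map -!filter_predI; apply/perm_of_eq/congr1/eq_filter => A /=.
  by rewrite [p + q]addnC eqn_add2r andbC.
rewrite filter_map -map_comp.
have -> : [seq x <- bridges p q s t | preim (fun A : segment => (A.1, A.2 + p))
             (fun A : segment => A.2 == p + q) x] = zip (drop m a) (nseq (c + p) q).
  rewrite -(proj2 st_split); apply: eq_in_filter => A.
  by move=> /(mem_bridges p0 q0 Rs Rt) [_ ? _ _] /=; lia.
rewrite (eq_map (_ : _ =1 fst)) // [map _ _]unzip1_zip //.
by rewrite size_drop size_a size_nseq; lia.
Qed.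

Let ends_K : sorted_ends K = b ++ [seq x + q | x <- drop m e].
Proof.
have /in_RP[Hu _] := Ru; have /in_RP[Ht _] := Rt.
have se : sorted leq e.
  rewrite /e -sorted_ends_cat; first exact: sort_sorted leq_total _.
  by move=> x /Hu[].
apply: (sorted_eq leq_trans anti_leq).
- exact: sort_sorted leq_total _.
- apply: (cat_sorted_rel leq_trans).
  + by apply: (sorted_filter leq_trans); apply: sort_sorted leq_total _.
  + rewrite sorted_map; apply: (@sub_sorted _ leq).
      by move=> x y; rewrite /= leq_add2r.
    exact: drop_sorted.
  + move=> x y; rewrite mem_filter => /andP[z1 _] /mapP[z _ ->].
    by lia.
rewrite perm_sort /K /concat_segments !filter_cat !map_cat.
have -> : [seq A <- [seq (A.1 + q, A.2 + q) | A <- u & 1 < A.1] | A.1 == 1] = [::].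
  apply/eqP; rewrite -[_ == _]negbK -has_filter -all_predC; apply/allP => A.
  by case/mapP => /= B; rewrite mem_filter => /andP[? _] -> /=; lia.
apply: perm_cat.
  rewrite perm_sym /b.
  apply: (@perm_trans _ [seq x <- [seq A.2 | A <- t & A.1 == 1] | x < q]).
    by apply: perm_filter; rewrite perm_sort.
  rewrite filter_map -!filter_predI; apply/perm_of_eq/congr1/eq_filter => A /=.
  by rewrite andbC.
rewrite /= filter_map -map_comp.
have -> : [seq x <- bridges q r t u | preim (fun A : segment => (A.1, A.2 + q))
             (fun A : segment => A.1 == 1) x] = zip (nseq (c + r) 1) (drop m e).
  rewrite -(proj2 tu_split); apply: eq_in_filter => A.
  by move=> /(mem_bridges q0 r0 Rt Ru) [? _ _ _] /=; lia.
rewrite (eq_map (_ : _ =1 (fun x => x + q) \o snd)) // map_comp.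
rewrite [[seq _.2 | _ <- zip _ _]]unzip2_zip //.
by rewrite size_drop size_e size_nseq; lia.
Qed.

Lemma concat_segmentsA :
  perm_eq (concat_segments (p + q) r L u) (concat_segments p (q + r) s K).
Proof.
have RL := in_R_concat p0 q0 Rs Rt; have RK := in_R_concat q0 r0 Rt Ru.
rewrite {1}/concat_segments bridgesE // starts_L.
rewrite [X in perm_eq _ X]/concat_segments bridgesE // ends_K.
have -> : [seq A <- L | A.2 < p + q] = [seq A <- s | A.2 < p] ++
   ([seq (A.1 + p, A.2 + p) | A <- t & (1 < A.1) && (A.2 < q)] ++
   [seq (A.1, A.2 + p) | A <- zip (take m a) b]).
  rewrite /L /concat_segments !filter_cat !filter_map; congr (_ ++ (_ ++ _)).
  - by apply/all_filterP/allP => A; rewrite mem_filter /=; lia.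
  - rewrite -filter_predI; congr map; apply: eq_filter => A /=.
    by rewrite andbC; congr (_ && _); lia.
  - rewrite -(proj1 st_split); congr map; apply: eq_filter => A /=; lia.
have -> : [seq A <- K | 1 < A.1] =
   [seq A <- t | (1 < A.1) && (A.2 < q)] ++
   ([seq (A.1 + q, A.2 + q) | A <- u & 1 < A.1] ++
   [seq (A.1, A.2 + q) | A <- zip d (take m e)]).
  rewrite /K /concat_segments !filter_cat !filter_map; congr (_ ++ (_ ++ _)).
  - by rewrite -filter_predI.
  - by congr map; apply/all_filterP/allP => A; rewrite mem_filter /=; lia.
  - by rewrite -(proj1 tu_split).
have -> : sorted_starts p s ++ nseq (q + r) 1 =
          take m a ++ (drop m a ++ nseq r 1).
  by rewrite catA cat_take_drop -catA -nseqD.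
have -> : sorted_ends u ++ nseq (p + q) r = take m e ++ (drop m e ++ nseq p r).
  by rewrite catA cat_take_drop /e -catA -nseqD addnC.
have sza : size (take m a) = m by rewrite size_take size_a; case: ltnP; lia.
have sze : size (take m e) = m by rewrite size_take size_e; case: ltnP; lia.
rewrite -!catA [zip ([seq x + p | x <- d] ++ _) _]zip_cat; last first.
  by rewrite size_map sze size_d.
rewrite [zip (take m a ++ _) _]zip_cat ?sza // !map_cat -!map_comp -?catA.
have -> : nseq p (q + r) = [seq x + q | x <- nseq p r].
  by rewrite map_nseq addnC.
rewrite -[[seq x + q | x <- drop m e] ++ _]map_cat zip_map_l zip_map_r -!map_comp.
do 2 (apply: perm_cat; first exact: perm_refl).
rewrite perm_catCA; apply: perm_cat.
  by apply/perm_of_eq/eq_map => A /=; congr (_, _); lia.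
rewrite perm_catCA; apply: perm_cat.
  by apply/perm_of_eq/eq_map => A /=; congr (_, _); lia.
apply: perm_cat; first exact: perm_refl.
by apply/perm_of_eq/eq_map => A /=; congr (_, _); lia.
Qed.

End ConcatAssoc.

Lemma multisegment_catA p q r (M N P : {mset segment}) :
  in_R p M -> in_R q N -> in_R r P ->
  multisegment_cat p (q + r) M (multisegment_cat q r N P) =
  multisegment_cat (p + q) r (multisegment_cat p q M N) P.
Proof.
move=> RM RN RP; rewrite /multisegment_cat !addn_eq0.
have [->|p0] := posnP p; first by rewrite add0n.
have [->|q0] := posnP q; first by rewrite add0n addn0; case: (p == 0).
have [->|r0] := posnP r; first by rewrite addn0 ?(gtn_eqF p0) ?(gtn_eqF q0).
rewrite ?(gtn_eqF p0) ?(gtn_eqF q0) /=.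
apply/eq_seq_msetP; rewrite perm_sym.
apply: perm_trans (perm_trans (concat_segmentsA p0 q0 r0 RM RN RP) _).
  by apply: concat_segments_perm => //; apply: perm_eq_seq_mset.
by apply: concat_segments_perm; rewrite // perm_sym perm_eq_seq_mset.
Qed.

Definition in_R_pair (x : nat * {mset segment}) : bool := in_R x.1 x.2.

(* The coproduct of the R_n is the set of the pairs (n, M) with M in R_n. *)
Record Rseg := RSeg {
  Rval : nat * {mset segment};
  _ : in_R_pair Rval
}.

HB.instance Definition _ := [isSub for Rval].
HB.instance Definition _ := [Choice of Rseg by <:].

Definition Rdegree (x : Rseg) : nat := (val x).1.
Definition Rmset (x : Rseg) : {mset segment} := (val x).2.

Lemma RsegP (x : Rseg) : in_R (Rdegree x) (Rmset x).
Proof. exact: (valP x). Qed.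

Lemma in_R0 (M : {mset segment}) : in_R 0 M -> M = mset0.
Proof.
move=> /in_RP[H _]; apply/msetP => A; rewrite mset0E; apply/mset_eq0P.
by apply/negP => /H[]; lia.
Qed.

Lemma Rmul_subproof (x y : Rseg) :
  in_R_pair (Rdegree x + Rdegree y,
             multisegment_cat (Rdegree x) (Rdegree y) (Rmset x) (Rmset y)).
Proof.
rewrite /in_R_pair /multisegment_cat /=.
have [p0|p0] := posnP (Rdegree x); first by rewrite p0; apply: RsegP.
have [q0|q0] := posnP (Rdegree y); first by rewrite q0 addn0; apply: RsegP.
by rewrite (in_R_perm _ (perm_eq_seq_mset _)) in_R_concat ?RsegP.
Qed.

Lemma Rone_subproof : in_R_pair (0, mset0).
Proof. by rewrite /in_R_pair /= enum_mset0. Qed.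

Lemma Rsusp_subproof (x : Rseg) :
  in_R_pair (Rdegree x + 2, multisegment_susp (Rdegree x) (Rmset x)).
Proof.
by rewrite /in_R_pair /= (in_R_perm _ (perm_eq_seq_mset _)) in_R_susp ?RsegP.
Qed.

Definition Rmul (x y : Rseg) : Rseg := RSeg (Rmul_subproof x y).
Definition Rone : Rseg := RSeg Rone_subproof.
Definition Rsusp (x : Rseg) : Rseg := RSeg (Rsusp_subproof x).

Lemma Rmul1 : left_id Rone Rmul.
Proof. by move=> x; apply: val_inj; case: x => -[]. Qed.

Lemma Rmulr1 : right_id Rone Rmul.
Proof.
case=> -[[|p] M] RM; apply: val_inj; rewrite /= /Rdegree /Rmset /= addn0 //.
by move/in_R0: RM => /= ->.
Qed.

Lemma RmulA : associative Rmul.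
Proof.
case=> -[p M] /= RM [[q N] RN] [[r P] RP]; apply: val_inj.
by rewrite /= /Rdegree /Rmset /= addnA multisegment_catA.
Qed.

HB.instance Definition _ := isMonoid.Build Rseg RmulA Rmul1 Rmulr1.
HB.instance Definition _ :=
  isGraded.Build Rseg (degree := Rdegree) erefl (fun x y => erefl).
HB.instance Definition _ :=
  hasSuspension.Build Rseg (suspension := Rsusp) (fun x => erefl).

Definition in_M (x : Rseg) : bool := at_most_one_cut (Rdegree x) (Rmset x).

Record Mseg := MSeg { Mval : Rseg; _ : in_M Mval }.

HB.instance Definition _ := [isSub for Mval].
HB.instance Definition _ := [Choice of Mseg by <:].

Lemma in_M_closed : monoid_closed in_M.
Proof.
split; first by rewrite unfold_in /in_M /Rmset /=.
move=> x y; rewrite !unfold_in /in_M /Rmset /= => Mx My.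
rewrite /multisegment_cat {1}/Rdegree /=.
have [p0|p0] := posnP (Rdegree x); first by rewrite p0.
have [q0|q0] := posnP (Rdegree y); first by rewrite q0 addn0.
rewrite (at_most_one_cut_perm _ (perm_eq_seq_mset _)).
by rewrite at_most_one_cut_concat ?RsegP.
Qed.

HB.instance Definition _ := SubChoice_isSubMonoid.Build Rseg in_M Mseg in_M_closed.

Definition Mdegree (x : Mseg) : nat := degree (val x).

Lemma Mdegree1 : Mdegree 1%g = 0.
Proof. by rewrite /Mdegree val1 degree1. Qed.

Lemma MdegreeM x y : Mdegree (x * y)%g = Mdegree x + Mdegree y.
Proof. by rewrite /Mdegree valM degreeM. Qed.

HB.instance Definition _ := isGraded.Build Mseg Mdegree1 MdegreeM.

Lemma Msusp_subproof (x : Mseg) : in_M (suspension (val x)).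
Proof.
rewrite /in_M /Rmset /= (at_most_one_cut_perm _ (perm_eq_seq_mset _)).
by apply: at_most_one_cut_susp; rewrite ?RsegP //; apply: (valP x).
Qed.

Definition Msusp (x : Mseg) : Mseg := MSeg (Msusp_subproof x).

HB.instance Definition _ := hasSuspension.Build Mseg
  (suspension := Msusp) (fun x => degree_suspension (val x)).

Definition in_E (x : Mseg) : bool := excessive (Rmset (val x)).

Record Eseg := ESeg { Eval : Mseg; _ : in_E Eval }.

HB.instance Definition _ := [isSub for Eval].
HB.instance Definition _ := [Choice of Eseg by <:].

Lemma in_E_closed : monoid_closed in_E.
Proof.
split; first by rewrite unfold_in /in_E val1 /Rmset /= enum_mset0.
move=> x y; rewrite !unfold_in /in_E valM /Rmset /= => Ex Ey.
rewrite /multisegment_cat.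
have [p0|p0] := posnP (Rdegree (val x)); first by [].
have [q0|q0] := posnP (Rdegree (val y)); first by [].
rewrite (excessive_perm (perm_eq_seq_mset _)).
by rewrite excessive_concat ?RsegP.
Qed.

HB.instance Definition _ := SubChoice_isSubMonoid.Build Mseg in_E Eseg in_E_closed.

Definition Edegree (x : Eseg) : nat := degree (val x).

Lemma Edegree1 : Edegree 1%g = 0.
Proof. by rewrite /Edegree val1 degree1. Qed.

Lemma EdegreeM x y : Edegree (x * y)%g = Edegree x + Edegree y.
Proof. by rewrite /Edegree valM degreeM. Qed.

HB.instance Definition _ := isGraded.Build Eseg Edegree1 EdegreeM.

Lemma Esusp_subproof (x : Eseg) : in_E (suspension (val x)).
Proof.
rewrite /in_E /Rmset /= (excessive_perm (perm_eq_seq_mset _)).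
by apply: excessive_susp; rewrite ?RsegP //; apply: (valP x).
Qed.

Definition Esusp (x : Eseg) : Eseg := ESeg (Esusp_subproof x).

HB.instance Definition _ := hasSuspension.Build Eseg
  (suspension := Esusp) (fun x => degree_suspension (val x)).

(* Main.v *)
Require Import Defs.
From mathcomp Require Import all_boot.
From HB Require Import structures.
From mathcomp Require Import finmap multiset zify.

Set Implicit Arguments.
Unset Strict Implicit.
Unset Printing Implicit Defensive.

Local Open Scope nat_scope.

(** Call a monoid with suspension uniquely decomposable if it has an element h
    of degree 1 such that every element other than 1 can be written in exactly
    one way as h * y or as S(a) * b. Such a monoid is the free one on h: its
    elements are the values of the terms built from 1, h * _ and S(_) * _, and
    distinct terms have distinct values. Two such monoids are therefore
    isomorphic as graded monoids with suspension. A homomorphism on such a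
    monoid is determined by the image of h, which is forced when the target has
    one element of degree 1. So it is enough to show that Motzkin paths and
    excessive multisegments are both uniquely decomposable
    ([motzkin_uniquely_decomposable], [Eseg_uniquely_decomposable]).

    For Motzkin paths, this is the decomposition at the first return to height
    0.

    For multisegments with at most one cut at every column, what plays the role
    of a return to 0 is a column which is not cut and such that the segments
    containing it are pairwise nested ([splits_at]): these are exactly the
    columns where the multisegment is a concatenation, because a chain of
    nested segments can be recovered from its starts and its ends
    ([split_concat], [splits_concat]), and the two factors are determined by
    the column ([concat_inj]).

    If an excessive multisegment of degree at least 2 has no cut at column 1,
    then it splits there and its first factor is h. If column 1 is cut, the
    multisegment contains [1, 1] and a segment [2, j]; let [1, m - 1] be the
    longest segment starting at 1 that ends before j. The absence of linked
    triples forces the multisegment to split at column m, unless m is already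
    its degree ([first_arch]); the first factor then contains [1, 1], [2, m],
    [1, m - 1] and [m, m], and for m > 2 removing these four segments exhibits
    it as a suspension ([desuspend]); for m = 2 it is the suspension of the
    empty multisegment ([desuspend0]). Conversely [1, 1], [1, m - 1] and [2, j]
    with j >= m prevent any splitting before column m, so m is unique
    ([arch_no_split]). *)

(** * Free monoids with suspension on one generator of degree 1 *)

(** The terms built from [Empty] by putting a flat step, or an arch over a
    first term, in front of a second term: the free monoid with suspension on
    one generator, in normal form. *)
Inductive word := Empty | Flat of word | Arch of word & word.

Fixpoint word_code (w : word) : GenTree.tree unit :=
  match w with
  | Empty => GenTree.Node 0 [::]
  | Flat u => GenTree.Node 1 [:: word_code u]
  | Arch u v => GenTree.Node 2 [:: word_code u; word_code v]
  end.

Fixpoint word_decode (t : GenTree.tree unit) : word :=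
  match t with
  | GenTree.Node 1 [:: u] => Flat (word_decode u)
  | GenTree.Node 2 [:: u; v] => Arch (word_decode u) (word_decode v)
  | _ => Empty
  end.

Lemma word_codeK : cancel word_code word_decode.
Proof. by elim=> //= [u -> | u -> v ->]. Qed.

HB.instance Definition _ := Choice.copy word (can_type word_codeK).

Fixpoint word_cat (u v : word) : word :=
  match u with
  | Empty => v
  | Flat u' => Flat (word_cat u' v)
  | Arch u1 u2 => Arch u1 (word_cat u2 v)
  end.

Record uniquely_decomposable (G : suspMonoidType) (h : G) : Prop := {
  degree_generator : degree h = 1;
  degree0_one : forall x : G, degree x = 0 -> x = 1%g;
  flat_inj : forall y y' : G, (h * y = h * y')%g -> y = y';
  arch_inj : forall a a' b b' : G,
    (suspension a * b = suspension a' * b')%g -> a = a' /\ b = b';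
  flat_not_arch : forall y a b : G, (h * y)%g <> (suspension a * b)%g;
  flat_or_arch : forall x : G, 0 < degree x ->
    (exists y, x = (h * y)%g) \/ (exists a b, x = (suspension a * b)%g)
}.

Section Evaluation.

Variables (G : suspMonoidType) (h : G).

Fixpoint eval (w : word) : G :=
  match w with
  | Empty => 1%g
  | Flat u => (h * eval u)%g
  | Arch u v => (suspension (eval u) * eval v)%g
  end.

Lemma eval_cat u v : eval (word_cat u v) = (eval u * eval v)%g.
Proof.
by elim: u => /= [|u ->|u _ w ->]; rewrite ?mul1g ?mulgA.
Qed.

Lemma eval_arch u : eval (Arch u Empty) = suspension (eval u).
Proof. exact: mulg1. Qed.

Hypothesis Gh : uniquely_decomposable h.

Lemma degree_flat y : degree (h * y)%g = (degree y).+1.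
Proof. by rewrite degreeM (degree_generator Gh). Qed.

Lemma degree_arch (a b : G) : degree (suspension a * b)%g = degree a + degree b + 2.
Proof. by rewrite degreeM degree_suspension addnAC. Qed.

Lemma eval_inj : injective eval.
Proof.
have d1 : degree (1%g : G) = 0 by apply: degree1.
elim=> [|u IH|u IHu v IHv] [|u'|u' v'] //= e.
- by have := congr1 degree e; rewrite degree_flat d1.
- by have := congr1 degree e; rewrite degree_arch d1; lia.
- by have := congr1 degree e; rewrite degree_flat d1.
- by rewrite (IH _ (flat_inj Gh e)).
- by case: (flat_not_arch Gh e).
- by have := congr1 degree e; rewrite degree_arch d1; lia.
- by case: (flat_not_arch Gh (esym e)).
- by have [/IHu -> /IHv ->] := arch_inj Gh e.
Qed.

Lemma eval_surj x : exists w, eval w == x.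
Proof.
have [n] := ubnP (degree x); elim: n x => // n IH x lxn.
have [/(degree0_one Gh) ->|] := posnP (degree x); first by exists Empty.
case/(flat_or_arch Gh) => [[y ex]|[a [b ex]]]; move: lxn; rewrite ex.
  rewrite degree_flat => lyn.
  have [|w /eqP ew] := IH y; first by lia.
  by exists (Flat w); rewrite /= ew.
rewrite degree_arch => lab.
have [|u /eqP eu] := IH a; first by lia.
have [|v /eqP ev] := IH b; first by lia.
by exists (Arch u v); rewrite /= eu ev.
Qed.

Definition parse (x : G) : word := xchoose (eval_surj x).

Lemma parseK : cancel parse eval.
Proof. by move=> x; apply/eqP/(xchooseP (eval_surj x)). Qed.

Lemma evalK : cancel eval parse.
Proof. by move=> w; apply: eval_inj; rewrite parseK. Qed.

Lemma parse1 : parse 1%g = Empty.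
Proof. exact: evalK Empty. Qed.

Lemma parseM x y : parse (x * y)%g = word_cat (parse x) (parse y).
Proof. by apply: eval_inj; rewrite eval_cat !parseK. Qed.

Lemma parse_suspension x : parse (suspension x) = Arch (parse x) Empty.
Proof. by apply: eval_inj; rewrite eval_arch !parseK. Qed.

End Evaluation.

Lemma degree_eval (G H : suspMonoidType) (g : G) (h : H) w :
  degree g = 1 -> degree h = 1 -> degree (eval g w) = degree (eval h w).
Proof.
move=> dg dh; elim: w => [|u IH|u IHu v IHv] /=; first by rewrite !degree1.
  by rewrite !degreeM dg dh IH.
by rewrite !degreeM !degree_suspension IHu IHv.
Qed.

Section Transport.

Variables (G H : suspMonoidType) (g : G) (h : H).
Hypotheses (Gg : uniquely_decomposable g) (Hh : uniquely_decomposable h).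

Definition transport (x : G) : H := eval h (parse Gg x).

Lemma transport_graded : graded_morphism transport.
Proof.
split; first split.
- by rewrite /transport parse1.
- by move=> x y; rewrite /transport parseM eval_cat.
- move=> x; rewrite -{2}(parseK Gg x).
  by apply: degree_eval; apply: degree_generator.
Qed.

Lemma transport_suspension : commutes_with_suspension transport.
Proof. by move=> x; rewrite /transport parse_suspension eval_arch. Qed.

End Transport.

Lemma transport_isomorphism (G H : suspMonoidType) (g : G) (h : H)
    (Gg : uniquely_decomposable g) (Hh : uniquely_decomposable h) :
  graded_isomorphism (transport h Gg).
Proof.
split; first exact: transport_graded.
exists (transport g Hh); split; first exact: transport_graded.
- by move=> x; rewrite /transport evalK parseK.
- by move=> x; rewrite /transport evalK parseK.
Qed.

(** A graded monoid with at most one element of degree 1 leaves no choice for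
    the image of the generator, and the generator determines everything
    else. *)
Lemma graded_morphism_unique (G H : suspMonoidType) (g : G) (f f' : G -> H) :
  uniquely_decomposable g ->
  (forall x y : H, degree x = 1 -> degree y = 1 -> x = y) ->
  graded_morphism f -> commutes_with_suspension f ->
  graded_morphism f' -> commutes_with_suspension f' -> f =1 f'.
Proof.
move=> Gg H1 [[f1 fM] fd] fS [[f'1 f'M] f'd] f'S x.
rewrite -(parseK Gg x); elim: (parse Gg x) => [|u IH|u IHu v IHv] /=.
- by rewrite f1 f'1.
- rewrite fM f'M IH; congr (_ * _)%g.
  by apply: H1; rewrite ?fd ?f'd; apply: degree_generator.
- by rewrite fM f'M fS f'S IHu IHv.
Qed.

(** * Motzkin paths *)

Definition height (x : motzkin) k := tagged x (inord k).

Lemma height_eq (x y : motzkin) : tag x = tag y ->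
  (forall k, k <= tag x -> height x k = height y k) -> x = y.
Proof. exact: motzkin_eq. Qed.

Lemma heightP (x : motzkin) :
  [/\ height x 0 = 0, height x (tag x) = 0 & forall k, k < tag x ->
    height x k <= (height x k.+1).+1 /\ height x k.+1 <= (height x k).+1].
Proof. exact: (is_motzkinP _ (valP (tagged x))). Qed.

Lemma height_mul (x y : motzkin) k : k <= tag x + tag y ->
  height (x * y)%g k =
    if k <= tag x then height x k else height y (k - tag x).
Proof. exact: path_catE. Qed.

Lemma height_mul_right (x y : motzkin) k : k <= tag y ->
  height (x * y)%g (tag x + k) = height y k.
Proof.
move=> lek; rewrite height_mul ?leq_add2l // addKn; case: (posnP k) => [->|k0].
  by rewrite addn0 leqnn; have [_ -> _] := heightP x; have [-> _ _] := heightP y.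
by rewrite ifF //; lia.
Qed.

Lemma height_suspension (x : motzkin) k : k <= tag x + 2 ->
  height (suspension x) k =
    if (k == 0) || (k == tag x + 2) then 0 else (height x k.-1).+1.
Proof. exact: path_suspE. Qed.

Lemma motzkin_of_height n (f : nat -> nat) : f 0 = 0 -> f n = 0 ->
  (forall k, k < n -> f k <= (f k.+1).+1 /\ f k.+1 <= (f k).+1) ->
  exists x : motzkin, tag x = n /\ forall k, k <= n -> height x k = f k.
Proof.
move=> f0 fn fS; pose g := [ffun i : 'I_n.+1 => f i].
have gE k : k <= n -> g (inord k) = f k by move=> lek; rewrite ffunE inordK.
have Mg : is_motzkin g.
  apply/is_motzkinP; rewrite !gE // f0 fn; split=> // k lk.
  by rewrite !gE; [exact: fS|exact: lk|exact: ltnW].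
exists (existT motzkin_path n (MotzkinPath Mg)); split=> // k; exact: gE.
Qed.

Lemma motzkin_mulI (x x' y y' : motzkin) : tag x = tag x' ->
  (x * y)%g = (x' * y')%g -> x = x' /\ y = y'.
Proof.
move=> exx e; have exy : tag y = tag y'.
  by have := congr1 (@tag _ _) e; rewrite /= exx; lia.
split; apply: height_eq => // k lek.
  have := congr1 (height^~ k) e; rewrite !height_mul; try lia.
  by rewrite -exx lek.
have := congr1 (height^~ (tag x + k)) e.
by rewrite height_mul_right // exx height_mul_right -?exy.
Qed.

Lemma suspension_inj (x y : motzkin) : suspension x = suspension y -> x = y.
Proof.
move=> e; have exy : tag x = tag y.
  by have := congr1 (@tag _ _) e; rewrite /=; lia.
apply: height_eq => // k lek.
have := congr1 (height^~ k.+1) e; rewrite !height_suspension; try lia.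
by rewrite ifF; [rewrite ifF; [case|lia]|lia].
Qed.

Lemma motzkin_split (x : motzkin) m : m <= tag x -> height x m = 0 ->
  exists y z : motzkin, tag y = m /\ x = (y * z)%g.
Proof.
move=> lem xm; have [x0 xn xS] := heightP x.
have [|y [dy hy]] := motzkin_of_height x0 xm.
  by move=> k lk; apply: xS; lia.
have [|||z [dz hz]] := @motzkin_of_height (tag x - m) (fun k => height x (m + k)).
- by rewrite addn0.
- by rewrite subnKC.
- by move=> k lk; rewrite addnS; apply: xS; lia.
exists y, z; split=> //; apply: height_eq => [|k lek]; first by rewrite /= dy dz; lia.
rewrite height_mul dy ?dz ?subnKC //; case: leqP => lkm; first by rewrite hy.
by rewrite hz ?subnKC //; lia.
Qed.

(** Such a path has height 1 next to its ends, so without them it can be lowered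
    by 1. *)
Lemma motzkin_desuspend (x : motzkin) : 1 < tag x ->
  (forall k, 0 < k < tag x -> 0 < height x k) -> exists y : motzkin, x = suspension y.
Proof.
move=> x1 xpos; have [x0 xn xS] := heightP x.
have h1 : height x 1 = 1.
  by have := xS 0 ltac:(lia); have := xpos 1 ltac:(lia); lia.
have hn : height x (tag x).-1 = 1.
  have := xS (tag x).-1 ltac:(lia); have := xpos (tag x).-1 ltac:(lia).
  by rewrite prednK ?xn; lia.
have [|||y [dy hy]] := @motzkin_of_height (tag x - 2) (fun k => (height x k.+1).-1).
- by rewrite h1.
- by have -> : (tag x - 2).+1 = (tag x).-1 by [lia]; rewrite hn.
- move=> k lk; have := xS k.+1 ltac:(lia).
  by have := xpos k.+1 ltac:(lia); have := xpos k.+2 ltac:(lia); lia.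
exists y; apply: height_eq => [|k lek]; first by rewrite /= dy; lia.
rewrite height_suspension dy; last by lia.
rewrite subnK //; case: (posnP k) => [->|k0] //=.
case: eqP => [->|nk] //=; rewrite hy; last by lia.
by rewrite prednK // prednK // xpos; lia.
Qed.

Lemma flat_step_subproof : is_motzkin [ffun _ : 'I_2 => 0].
Proof. by apply/is_motzkinP; split=> [||k _]; rewrite !ffunE. Qed.

Definition flat_step : motzkin :=
  existT motzkin_path 1 (MotzkinPath flat_step_subproof).

Lemma height_flat_step k : height flat_step k = 0.
Proof. exact: ffunE. Qed.

Lemma eq_flat_step (x : motzkin) : tag x = 1 -> x = flat_step.
Proof.
move=> x1; have [x0 xn _] := heightP x; apply: height_eq => // k lek.
rewrite height_flat_step; rewrite x1 in xn lek.
by case: k lek => [|[|]].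
Qed.

(** In a product of a suspension with another path, the suspension ends at
    the first return to height 0. *)
Lemma height_arch_gt0 (a b : motzkin) k : 0 < k < tag a + 2 ->
  0 < height (suspension a * b)%g k.
Proof.
move=> lk; rewrite height_mul /=; last by lia.
by rewrite ifT ?height_suspension ?ifF; lia.
Qed.

Lemma height_arch_end (a b : motzkin) :
  height (suspension a * b)%g (tag a + 2) = 0.
Proof.
rewrite height_mul /= ?leqnn; last by lia.
by rewrite height_suspension // eqxx orbT.
Qed.

Lemma motzkin_uniquely_decomposable : uniquely_decomposable flat_step.
Proof.
split=> //.
- by move=> x dx; apply: height_eq => //= k; rewrite [tag x]dx leqn0 => /eqP ->;
    have [-> _ _] := heightP x; have [-> _ _] := heightP 1%g.
- by move=> y y' /motzkin_mulI[].
- move=> a a' b b' e; have ea : tag a = tag a'.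
    case: (ltngtP (tag a) (tag a')) => // l.
      by have := @height_arch_gt0 a' b' (tag a + 2); rewrite -e height_arch_end; lia.
    by have := @height_arch_gt0 a b (tag a' + 2); rewrite e height_arch_end; lia.
  by have [|/suspension_inj] := motzkin_mulI _ e; rewrite //= ea.
- move=> y a b e; have := @height_arch_gt0 a b 1 ltac:(lia).
  by rewrite -e height_mul //= height_flat_step.
- move=> x x0; have [_ xn _] := heightP x.
  (* the first return to height 0 *)
  have [|m /andP[m0 /eqP xm] mmin] := @ex_minnP (fun k => (0 < k) && (height x k == 0)).
    by exists (tag x); rewrite xn eqxx andbT.
  have lem : m <= tag x by apply: mmin; rewrite xn eqxx andbT.
  have [y [z [dy exyz]]] := motzkin_split lem xm.
  case: (ltnP 1 m) => [m1|m1]; last first.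
    by left; exists z; rewrite exyz (@eq_flat_step y) // dy; lia.
  right; have [|k|a ya] := @motzkin_desuspend y; first by rewrite dy.
    rewrite dy => lk; rewrite lt0n; apply/negP => /eqP yk.
    have := mmin k; rewrite exyz height_mul dy; last by lia.
    by rewrite ifT ?yk; lia.
  by exists a, z; rewrite exyz ya.
Qed.

(** * Cuts *)

Lemma count_le1_inj (T : eqType) (a : pred T) (s : seq T) x y :
  count a s <= 1 -> x \in s -> y \in s -> a x -> a y -> x = y.
Proof.
rewrite -size_filter => c1 xs ys ax ay.
have: x \in filter a s by rewrite mem_filter ax.
have: y \in filter a s by rewrite mem_filter ay.
by case: (filter a s) c1 => [|z [|]] //= _; rewrite !inE => /eqP -> /eqP ->.
Qed.

Lemma count_segment_end n s k : in_R n s ->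
  count (in_segment k) s =
    count (in_column k) s + count (fun A : segment => A.2 == k) s.
Proof.
move=> /in_RP[Hs _].
rewrite (count_split (fun A : segment => A.2 != k) (in_segment k)).
by congr (_ + _); apply: eq_in_count => A /Hs[]; rewrite /in_segment /in_column /=; lia.
Qed.

Lemma count_segment_start n s k : in_R n s ->
  count (in_segment k.+1) s =
    count (in_column k) s + count (fun A : segment => A.1 == k.+1) s.
Proof.
move=> /in_RP[Hs _].
rewrite (count_split (fun A : segment => A.1 != k.+1) (in_segment k.+1)).
by congr (_ + _); apply: eq_in_count => A /Hs[]; rewrite /in_segment /in_column /=; lia.
Qed.

Lemma count_ends n s k : in_R n s -> 0 < k <= n ->
  count (fun A : segment => A.2 == k) s = cuts n s k.
Proof.
by move=> Rs lk; rewrite /cuts; have /in_RP[_ /(_ k lk) <-] := Rs;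
  rewrite (count_segment_end _ Rs) addKn.
Qed.

Lemma count_starts n s k : in_R n s -> 0 < k < n ->
  count (fun A : segment => A.1 == k.+1) s = cuts n s k.
Proof.
move=> Rs lk; rewrite /cuts; have /in_RP[_ /(_ k.+1 ltac:(lia)) <-] := Rs.
by rewrite (count_segment_start _ Rs) addKn.
Qed.

Lemma at_most_one_cutP n s :
  reflect (forall k, 0 < k < n -> cuts n s k <= 1) (at_most_one_cut n s).
Proof.
apply: (iffP allP) => H k lk; first by apply: H; rewrite mem_iota; lia.
by apply: H; move: lk; rewrite mem_iota; lia.
Qed.

Lemma end_start n s i k : in_R n s -> 0 < k < n -> (i, k) \in s -> exists j, (k.+1, j) \in s.
Proof.
move=> Rs lk ms.
have: has (fun A : segment => A.1 == k.+1) s.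
  rewrite has_count (count_starts Rs) // -(count_ends Rs) -?has_count; last by lia.
  by apply/hasP; exists (i, k) => /=.
by case/hasP => -[i' j] /= ? /eqP <-; exists j.
Qed.

Lemma start_end n s j k : in_R n s -> 0 < k < n -> (k.+1, j) \in s -> exists i, (i, k) \in s.
Proof.
move=> Rs lk ms.
have: has (fun A : segment => A.2 == k) s.
  rewrite has_count (count_ends Rs) -?(count_starts Rs) -?has_count; try lia.
  by apply/hasP; exists (k.+1, j) => /=.
by case/hasP => -[i j'] /= ? /eqP <-; exists i.
Qed.

Section AtMostOneCut.

Variables (n : nat) (s : seq segment).
Hypotheses (Rs : in_R n s) (Cs : at_most_one_cut n s).

Lemma end_inj i i' k : 0 < k < n -> (i, k) \in s -> (i', k) \in s -> i = i'.
Proof.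
move=> lk ms ms'; suff: (i, k) = (i', k) by case.
apply: (@count_le1_inj _ (fun A : segment => A.2 == k) s) => //=.
by rewrite (count_ends Rs); [apply/at_most_one_cutP: lk|lia].
Qed.

Lemma start_inj j j' k : 0 < k < n -> (k.+1, j) \in s -> (k.+1, j') \in s -> j = j'.
Proof.
move=> lk ms ms'; suff: (k.+1, j) = (k.+1, j') by case.
apply: (@count_le1_inj _ (fun A : segment => A.1 == k.+1) s) => //=.
by rewrite (count_starts Rs) //; apply/at_most_one_cutP: lk.
Qed.

(** A start other than 1 comes from a cut, so there are few of them. *)
Lemma count_late_starts p : 0 < p <= n ->
  count (fun A : segment => 1 < A.1 <= p) s < p.
Proof.
elim: p => // -[|p] IH lp.
  by rewrite (eq_count (_ : _ =1 xpred0)) ?count_pred0 // => A /=; lia.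
rewrite (count_split (fun A : segment => A.1 <= p.+1)).
rewrite (eq_count (_ : _ =1 (fun A : segment => 1 < A.1 <= p.+1))); last first.
  by move=> A /=; lia.
have := at_most_one_cutP _ _ Cs p.+1 ltac:(lia); rewrite -(count_starts Rs); last lia.
have := IH ltac:(lia).
rewrite [X in _ -> _ -> _ + X < _](eq_count (_ : _ =1 (fun A : segment => A.1 == p.+2))).
  lia.
by move=> A /=; lia.
Qed.

(** Likewise, an end other than n comes from a cut. *)
Lemma count_early_ends q : q < n ->
  count (fun A : segment => n - q <= A.2 < n) s <= q.
Proof.
elim: q => [|q IH] lq.
  by rewrite (eq_count (_ : _ =1 xpred0)) ?count_pred0 // => A /=; lia.
rewrite (count_split (fun A : segment => n - q <= A.2)).
rewrite (eq_count (_ : _ =1 (fun A : segment => n - q <= A.2 < n))); last first.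
  by move=> A /=; lia.
have := at_most_one_cutP _ _ Cs (n - q.+1) ltac:(lia).
rewrite -(count_ends Rs); last lia.
have := IH ltac:(lia).
rewrite [X in _ -> _ -> _ + X <= _](eq_count (_ : _ =1 (fun A : segment => A.2 == n - q.+1))).
  lia.
by move=> A /=; lia.
Qed.

End AtMostOneCut.

(** * Splitting a multisegment at a column *)

Definition nested (A B : segment) : bool := (B.1 <= A.1) && (A.2 <= B.2).

(** The shape of a concatenation at the column where its factors meet: the
    column is not cut, and the segments containing it form a chain. *)
Definition splits_at p (s : seq segment) : Prop :=
  {in s, forall A : segment, A.2 != p} /\
  {in [seq A <- s | in_column p A] &, forall A B, nested A B || nested B A}.

(** A chain is recovered from its starts and its ends, so the third clause in
    the definition of the concatenation gives back the segments that were cut. *)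
Lemma zip_sorted_chain (c : seq segment) :
  {in c &, forall A B, nested A B || nested B A} ->
  perm_eq (zip (sort geq (unzip1 c)) (sort leq (unzip2 c))) c.
Proof.
move=> tot; pose c' := sort nested c.
have pc : perm_eq c' c by rewrite perm_sort.
have sc : sorted nested c'.
  by apply: (@sort_sorted_in _ (mem c)) => //; apply/allP.
rewrite (_ : sort geq _ = unzip1 c'); last first.
  apply: (sorted_eq geq_trans geq_anti); first exact: sort_sorted geq_total _.
    rewrite sorted_map; apply: sub_sorted sc => A B /andP[]; exact.
  by rewrite perm_sort perm_sym; apply: perm_map.
rewrite (_ : sort leq _ = unzip2 c'); last first.
  apply: (sorted_eq leq_trans anti_leq); first exact: sort_sorted leq_total _.
    by rewrite sorted_map; apply: sub_sorted sc => A B /andP[].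
  by rewrite perm_sort perm_sym; apply: perm_map.
by rewrite zip_unzip.
Qed.

Section Split.

Variables (p q : nat) (s : seq segment).
Hypotheses (p0 : 0 < p) (q0 : 0 < q).
Hypotheses (Rs : in_R (p + q) s) (Cs : at_most_one_cut (p + q) s).
Hypothesis splits : splits_at p s.

Let c := [seq A <- s | in_column p A].
Let a := sort geq (unzip1 c).
Let e := sort leq (unzip2 c).

Let size_c : size c = p + q + 1.
Proof.
have /in_RP[_ /(_ p ltac:(lia)) <-] := Rs; rewrite size_filter.
rewrite (count_segment_end _ Rs) [X in _ = _ + X](eq_in_count (_ : {in s, _ =1 xpred0})).
  by rewrite count_pred0 addn0.
by move=> A As; apply/negbTE/splits.1.
Qed.

Let start_neq (A : segment) : A \in s -> A.1 != p.+1.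
Proof.
case: A => i j ms; apply/eqP => /= ei; rewrite ei in ms.
have [//|i' ms'] := start_end Rs _ ms; first by lia.
by have := splits.1 _ ms'; rewrite /= eqxx.
Qed.

Let memc (A : segment) : A \in c -> [/\ A \in s, 1 <= A.1, A.1 <= p, p < A.2 & A.2 <= p + q].
Proof.
rewrite mem_filter => /andP[/andP[? ?] As].
by have /in_RP[Hs _] := Rs; have [] := Hs A As.
Qed.

(* At most p - 1 segments start between 2 and p, so at least q + 2 of the
   p + q + 1 starts are equal to 1: the last q can be given up. *)
Let aE : a = take (p + 1) a ++ nseq q 1.
Proof.
have a1 : all (fun x => 1 <= x) a.
  by apply/allP => x; rewrite mem_sort => /mapP[A /memc[]] ? ? ? ? ? ->.
have sa := sorted_split_min (sort_sorted geq_total _) a1.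
rewrite -/a in sa; set b := [seq _ <- _ | _] in sa.
have sz : size a = p + q + 1 by rewrite size_sort size_map.
have lb : size b < p.
  apply: leq_ltn_trans (count_late_starts Rs Cs (_ : 0 < p <= p + q)); last by lia.
  rewrite /b size_filter count_sort count_map count_filter.
  by apply: sub_count => A /=; rewrite /in_column; lia.
rewrite -{1}[a](cat_take_drop (p + 1)); congr (_ ++ _).
rewrite sa drop_cat ifF; last by lia.
rewrite drop_nseq; congr nseq.
by have := congr1 size sa; rewrite size_cat size_nseq; lia.
Qed.

(* At most q - 1 segments end between p + 1 and p + q - 1, so at least p + 2 of
   the ends are equal to p + q. *)
Let eE : e = take (q + 1) e ++ nseq p (p + q).
Proof.
have e1 : all (fun x => x <= p + q) e.
  by apply/allP => x; rewrite mem_sort => /mapP[A /memc[]] ? ? ? ? ? ->.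
have se := sorted_split_max (sort_sorted leq_total _) e1.
rewrite -/e in se; set b := [seq _ <- _ | _] in se.
have sz : size e = p + q + 1 by rewrite size_sort size_map.
have lb : size b <= q.
  apply: leq_trans (count_early_ends Rs Cs (_ : q < p + q)); last by lia.
  rewrite /b size_filter count_sort count_map count_filter.
  by apply: sub_count => A /=; rewrite /in_column; lia.
rewrite -{1}[e](cat_take_drop (q + 1)); congr (_ ++ _).
rewrite se drop_cat ifF; last by lia.
rewrite drop_nseq; congr nseq.
by have := congr1 size se; rewrite size_cat size_nseq; lia.
Qed.

(* The factors: the segments on one side of column p, and the trace on that
   side of the segments containing it, but for the copies of the full segment
   that the concatenation adds. *)
Let s1 := [seq A <- s | A.2 < p] ++ [seq (i, p) | i <- take (p + 1) a].
Let s2 := [seq (A.1 - p, A.2 - p) | A <- s & p < A.1] ++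
          [seq (1, j - p) | j <- take (q + 1) e].

Let count_s (b : pred segment) :
  count b s = count b [seq A <- s | A.2 < p] + count b c +
              count b [seq A <- s | p < A.1].
Proof.
rewrite (count_split (fun A : segment => A.2 < p)) -addnA !count_filter.
rewrite [X in _ + X = _](count_split (in_column p)).
have /in_RP[Hs _] := Rs.
by congr (_ + (_ + _)); apply: eq_in_count => A As; have [? ? ?] := Hs A As;
   have := splits.1 A As; rewrite /in_column /=; case: (b A); lia.
Qed.

Let s1_in_R : in_R p s1.
Proof.
have /in_RP[Hs Hs'] := Rs; apply/in_RP; split.
  move=> A; rewrite mem_cat mem_filter => /orP[/andP[? /Hs[]]|/mapP[i]].
    by split; lia.
  move=> /mem_take; rewrite mem_sort => /mapP[B /memc[? ? ? ? ?] -> ->] /=.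
  by split; lia.
move=> k lk; have := Hs' k ltac:(lia); rewrite count_s.
rewrite [X in _ + X](eq_in_count (_ : {in _, _ =1 xpred0})); last first.
  by move=> A; rewrite mem_filter /in_segment; lia.
rewrite count_pred0 addn0 count_cat count_map.
have -> : count (in_segment k) c = count (fun i => i <= k) a.
  rewrite count_sort count_map; apply: eq_in_count => A /memc[].
  by rewrite /in_segment /=; lia.
rewrite {1}aE count_cat count_nseq (andP lk).1 mul1n.
rewrite [count (preim _ _) (take _ _)](eq_in_count (_ : {in take _ _, _ =1 fun i => i <= k})).
  by rewrite addnA [p + q + 1]addnAC => /addIn.
by move=> i _; rewrite /in_segment /=; lia.
Qed.

Let s2_in_R : in_R q s2.
Proof.
have /in_RP[Hs Hs'] := Rs; apply/in_RP; split.
  move=> A; rewrite mem_cat => /orP[/mapP[B]|/mapP[j]].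
    by rewrite mem_filter => /andP[? /Hs[? ? ?]] -> /=; split; lia.
  move=> /mem_take; rewrite mem_sort => /mapP[B /memc[? ? ? ? ?] -> ->] /=.
  by split; lia.
move=> k lk; have := Hs' (p + k) ltac:(lia); rewrite count_s.
rewrite (eq_in_count (_ : {in [seq _ <- _ | _.2 < p], _ =1 xpred0})); last first.
  by move=> A; rewrite mem_filter /in_segment; lia.
rewrite count_pred0 add0n count_cat !count_map.
have -> : count (in_segment (p + k)) c = count (fun j => p + k <= j) e.
  rewrite count_sort count_map; apply: eq_in_count => A /memc[].
  by rewrite /in_segment /=; lia.
rewrite {1}eE count_cat count_nseq leq_add2l (andP lk).2 mul1n.
rewrite [count (preim _ _) (take _ _)](eq_in_count (_ : {in take _ _, _ =1 fun j => p + k <= j})); last first.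
  by move=> i _; rewrite /in_segment /=; lia.
rewrite [count (preim _ _) _](eq_in_count (_ : {in [seq _ <- _ | p < _.1], _ =1 in_segment (p + k)})).
  by rewrite addnAC -[p + q + 1]addnA [p + (q + 1)]addnC => /addIn h; rewrite addnC.
by move=> A; rewrite mem_filter /in_segment /= => /andP[? /Hs[]]; lia.
Qed.

Let s1_starts : sorted_starts p s1 = take (p + 1) a.
Proof.
apply: (sorted_eq geq_trans geq_anti).
- exact: sort_sorted geq_total _.
- exact: take_sorted (sort_sorted geq_total _).
rewrite perm_sort filter_cat map_cat filter_map -map_comp.
rewrite (eq_in_filter (_ : {in _, _ =1 xpred0})); last first.
  by move=> A; rewrite mem_filter => /andP[lA _]; apply: ltn_eqF.
rewrite filter_pred0 cat0s (eq_filter (_ : _ =1 xpredT)) ?filter_predT ?map_id //.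
by move=> i /=; rewrite eqxx.
Qed.

Let s2_ends : sorted_ends s2 = [seq j - p | j <- take (q + 1) e].
Proof.
apply: (sorted_eq leq_trans anti_leq).
- exact: sort_sorted leq_total _.
- rewrite sorted_map; apply: (@sub_sorted _ leq) => [i j /=|]; first by lia.
  exact: take_sorted (sort_sorted leq_total _).
rewrite perm_sort filter_cat map_cat !filter_map -!map_comp.
rewrite (eq_in_filter (_ : {in [seq _ <- s | _], _ =1 xpred0})); last first.
  by move=> A; rewrite mem_filter => /andP[? /start_neq] /=; lia.
by rewrite filter_pred0.
Qed.

(** The concatenation pairs the starts and the ends of the segments containing
    column p as they were, because these segments form a chain. *)
Lemma split_concat : exists s1 s2, [/\ in_R p s1, in_R q s2 &
  perm_eq s (concat_segments p q s1 s2)].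
Proof.
exists s1, s2; split=> //; have /in_RP[Hs _] := Rs.
rewrite /concat_segments bridgesE // s1_starts -aE s2_ends.
have -> : nseq p q = [seq j - p | j <- nseq p (p + q)] by rewrite map_nseq addKn.
rewrite -map_cat -eE zip_map_r -map_comp.
rewrite [[seq _ | _ <- zip a e]](_ : _ = zip a e); last first.
  rewrite -[RHS]map_id; apply/eq_in_map => -[i j] /mem_zip[_].
  rewrite mem_sort => /= /mapP[A /memc[_ _ _ lA _] ->].
  by rewrite /= subnK // ltnW.
have -> : [seq A <- s1 | A.2 < p] = [seq A <- s | A.2 < p].
  rewrite filter_cat filter_id [X in _ ++ X](_ : _ = [::]) ?cats0 //.
  rewrite filter_map (eq_filter (_ : _ =1 xpred0)) ?filter_pred0 //.
  by move=> i; rewrite /= ltnn.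
have -> : [seq (A.1 + p, A.2 + p) | A <- s2 & 1 < A.1] = [seq A <- s | p < A.1].
  rewrite filter_cat !filter_map -filter_predI map_cat -map_comp.
  rewrite [[seq _ | _ <- [seq _ <- take _ _ | _]]](_ : _ = [::]) ?cats0; last first.
    by rewrite (eq_filter (_ : _ =1 xpred0)) ?filter_pred0.
  rewrite (eq_in_filter (_ : {in s, _ =1 fun A : segment => p < A.1})); last first.
    by move=> A /start_neq /=; lia.
  rewrite -[RHS]map_id; apply/eq_in_map => -[i j]; rewrite mem_filter /=.
  by move=> /andP[? /Hs[]] /= *; rewrite !subnK //; lia.
apply/permP => b; rewrite count_s !count_cat.
rewrite (permP (zip_sorted_chain splits.2)) -/c -addnA; congr (_ + _).
by rewrite addnC !count_filter.
Qed.

End Split.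

(** * The factors of a concatenation *)

Section Factors.

Variables (p q : nat) (s t : seq segment).
Hypotheses (p0 : 0 < p) (q0 : 0 < q) (Rs : in_R p s) (Rt : in_R q t).

Let size_st : size (sorted_starts p s ++ nseq q 1) = size (sorted_ends t ++ nseq p q).
Proof.
rewrite !size_cat !size_nseq (size_sorted_starts p0 Rs) (size_sorted_ends q0 Rt).
by lia.
Qed.

Lemma extend_right i : (i, p) \in s ->
  exists j, p < j /\ (i, j) \in concat_segments p q s t.
Proof.
move=> ms; have: i \in unzip1 (bridges p q s t).
  by rewrite bridgesE // unzip1_zip ?size_st // mem_cat mem_sorted_starts ms.
case/mapP => /= B Bs ->; have [_ lB _ _] := mem_bridges p0 q0 Rs Rt Bs.
exists (B.2 + p); split; first by lia.
rewrite !mem_cat; apply/orP; right; apply/orP; right.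
by apply/mapP; exists B.
Qed.

Lemma extend_left j : (1, j) \in t ->
  exists i, 1 <= i <= p /\ (i, j + p) \in concat_segments p q s t.
Proof.
move=> mt; have: j \in unzip2 (bridges p q s t).
  by rewrite bridgesE // unzip2_zip ?size_st // mem_cat mem_sorted_ends mt.
case/mapP => /= B Bs ->; have [lB _ _ _] := mem_bridges p0 q0 Rs Rt Bs.
exists B.1; split; first by lia.
rewrite !mem_cat; apply/orP; right; apply/orP; right.
by apply/mapP; exists B.
Qed.

Lemma mem_concat_left (A : segment) : A \in s -> A.2 < p -> A \in concat_segments p q s t.
Proof. by move=> As lA; rewrite !mem_cat mem_filter lA As. Qed.

Lemma mem_concat_right (A : segment) : A \in t -> 1 < A.1 ->
  (A.1 + p, A.2 + p) \in concat_segments p q s t.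
Proof.
move=> At lA; rewrite !mem_cat; apply/orP; right; apply/orP; left.
by apply/mapP; exists A; rewrite ?mem_filter ?lA.
Qed.

(** A segment which starts after 1 and ends in the right factor comes from the
    left factor, where it is cut off at the last point. *)
Lemma truncate_right i j : (i, j) \in concat_segments p q s t ->
  1 < i -> i <= p -> p < j -> (i, p) \in s.
Proof.
have /in_RP[Hs _] := Rs; have /in_RP[Ht _] := Rt.
move=> + i1 ip pj; case/mem_concat => [[/Hs[] /= *]|[B [/Ht[? ? ?] ? [? _]]]|[B [Bs [eB _]]]].
- by lia.
- by lia.
- by have [_ _ + _] := mem_bridges p0 q0 Rs Rt Bs; rewrite eB; apply; rewrite -eB.
Qed.

Lemma mem_concat_before (A : segment) :
  A \in concat_segments p q s t -> A.2 < p -> A \in s.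
Proof.
case/mem_concat => [[]//|[B [_ _ ->]]|[B [_ ->]]] /=.
  by rewrite ltnNge leq_addl.
by rewrite ltnNge leq_addl.
Qed.

Lemma splits_concat : splits_at p (concat_segments p q s t).
Proof.
have /in_RP[Hs _] := Rs; have /in_RP[Ht _] := Rt.
have crossing A : A \in [seq A <- concat_segments p q s t | in_column p A] ->
    exists B : segment, B \in bridges p q s t /\ A = (B.1, B.2 + p).
  rewrite mem_filter => /andP[/andP[A1 A2] /mem_concat[[_ ?]|[B [/Ht[? ? ?] ? eA]]|//]].
    by lia.
  by move: A1; rewrite eA /=; lia.
split=> [A /mem_concat[[_ lA]|[B [/Ht[? ? ?] _ ->]]|[B [Bs ->]]]|].
- by rewrite ltn_eqF.
- by rewrite /=; lia.
- by have [_ lB _ _] := mem_bridges p0 q0 Rs Rt Bs; rewrite /=; lia.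
- move=> A B /crossing[A' [As ->]] /crossing[B' [Bs ->]]; rewrite /nested /=.
  have := bridges_unlinked p0 q0 Rs Rt As Bs.
  by have := bridges_unlinked p0 q0 Rs Rt Bs As; lia.
Qed.

Lemma cuts_concat_left k : 0 < k < p ->
  cuts (p + q) (concat_segments p q s t) k = cuts p s k.
Proof.
have /in_RP[Hs _] := Rs; have /in_RP[Ht _] := Rt.
move=> lk; rewrite /cuts (@count_concat_left _ _ _ _ p0 q0 Rs Rt (in_column k) _ k).
- by lia.
- by [].
- by move=> A /Ht[]; rewrite /in_column /=; lia.
- by move=> A /(mem_bridges p0 q0 Rs Rt)[]; rewrite /in_column /=; lia.
- by move=> A /Hs[]; rewrite /in_column /=; lia.
- by lia.
Qed.

Lemma cuts_concat_right k : 0 < k < q ->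
  cuts (p + q) (concat_segments p q s t) (k + p) = cuts q t k.
Proof.
have /in_RP[Hs _] := Rs; have /in_RP[Ht _] := Rt.
move=> lk; rewrite /cuts.
rewrite (@count_concat_right _ _ _ _ p0 q0 Rs Rt (in_column k) _ k.+1).
- by lia.
- by move=> A /Ht[]; rewrite /in_column /=; lia.
- by move=> A /Hs[]; rewrite /in_column /=; lia.
- by move=> A /(mem_bridges p0 q0 Rs Rt)[]; rewrite /in_column /=; lia.
- by move=> A /Ht[]; rewrite /in_column /=; lia.
- by lia.
Qed.

Lemma at_most_one_cut_factors : at_most_one_cut (p + q) (concat_segments p q s t) ->
  at_most_one_cut p s /\ at_most_one_cut q t.
Proof.
move=> /at_most_one_cutP C; split; apply/at_most_one_cutP => k lk.
  by rewrite -cuts_concat_left //; apply: C; lia.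
by rewrite -cuts_concat_right //; apply: C; lia.
Qed.

(** A linked triple of a factor is also one of the concatenation, since only
    its last (in the left factor) or its first segment (in the right factor)
    may have to be extended. *)
Lemma excessive_factors : excessive (concat_segments p q s t) ->
  excessive s /\ excessive t.
Proof.
have /in_RP[Hs _] := Rs; have /in_RP[Ht _] := Rt.
move=> /(excessiveP (in_R_concat p0 q0 Rs Rt)) E.
split.
  apply/(excessiveP Rs) => A B C As Bs Cs /and5P[h1 h2 h3 h4 /and3P[h5 h6 h7]].
  have [? ? ?] := Hs _ As; have [? ? ?] := Hs _ Bs; have [? ? lC] := Hs _ Cs.
  have mA := mem_concat_left As ltac:(lia); have mB := mem_concat_left Bs ltac:(lia).
  case: (ltnP C.2 p) => lCp.
    by apply: (E A B C mA mB (mem_concat_left Cs lCp)); rewrite h1 h2 h3 h4 h5 h6 h7.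
  have eC : C.2 = p by lia.
  have [|j [lj mC]] := @extend_right C.1; first by rewrite -{1}eC -surjective_pairing.
  by apply: (E A B _ mA mB mC); rewrite /= h1 h2 h3 h4 h6 h7; lia.
apply/(excessiveP Rt) => A B C At Bt Ct /and5P[h1 h2 h3 h4 /and3P[h5 h6 h7]].
have [A1 A2 A3] := Ht _ At; have [B1 B2 B3] := Ht _ Bt; have [C1 C2 C3] := Ht _ Ct.
have mB := mem_concat_right Bt ltac:(lia); have mC := mem_concat_right Ct ltac:(lia).
case: (ltnP 1 A.1) => lA.
  by apply: (E _ _ _ (mem_concat_right At lA) mB mC); rewrite /=; lia.
have eA : A.1 = 1 by lia.
have [|i [li mA]] := @extend_left A.2; first by rewrite -{1}eA -surjective_pairing.
by apply: (E _ _ _ mA mB mC); rewrite /=; lia.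
Qed.

(** Restricting the segments of the concatenation to [1, p] gives back the
    left factor, together with the copies of [1, p] that were added to it. *)
Lemma count_restrict_left (a : pred segment) :
  count (fun A : segment => if A.2 < p then a A else (A.1 <= p) && a (A.1, p))
    (concat_segments p q s t) = count a s + a (1, p) * q.
Proof.
have /in_RP[Hs _] := Rs; have /in_RP[Ht _] := Rt.
rewrite /concat_segments !count_cat !count_map.
rewrite [count _ [seq _ <- t | _]](eq_in_count (_ : {in _, _ =1 xpred0})); last first.
  case=> i j; rewrite mem_filter => /andP[/= i1 /Ht[/= _ lij _]].
  rewrite ltnNge leq_addl /= leqNgt -{1}[p]add0n ltn_add2r ltnW //.
rewrite count_pred0 add0n.
rewrite [count _ (bridges _ _ _ _)](eq_in_count
  (_ : {in _, _ =1 fun B : segment => a (B.1, p)})); last first.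
  move=> /= A /(mem_bridges p0 q0 Rs Rt)[/andP[_ lA] ? _ _] /=.
  have [-> ->] // : (A.2 + p < p) = false /\ (A.1 <= p) = true by lia.
rewrite bridgesE // (@count_zip_fst (fun i => a (i, p))) ?size_st //.
rewrite count_cat count_nseq addnA; congr (_ + _).
rewrite count_sorted_starts count_filter.
rewrite (count_split (fun A : segment => A.2 < p) a); congr (_ + _).
  by apply: eq_count => A /=; case: (A.2 < p); rewrite ?andbF ?andbT.
apply: eq_in_count => -[i j] /Hs[_ _] /=; rewrite -leqNgt leq_eqVlt => /orP[/eqP ->|lj].
  by rewrite eqxx leqnn.
by rewrite (ltn_eqF lj) leqNgt lj !andbF.
Qed.

Lemma count_restrict_right (a : pred segment) :
  count (fun A : segment => if p < A.1 then a (A.1 - p, A.2 - p)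
                            else (p < A.2) && a (1, A.2 - p))
    (concat_segments p q s t) = count a t + a (1, q) * p.
Proof.
have /in_RP[Hs _] := Rs; have /in_RP[Ht _] := Rt.
rewrite /concat_segments !count_cat !count_map.
rewrite [count _ [seq _ <- s | _]](eq_in_count (_ : {in _, _ =1 xpred0})); last first.
  case=> i j; rewrite mem_filter => /andP[/= lj /Hs[/= _ lij _]].
  by rewrite !ltnNge (leq_trans lij) ltnW.
rewrite count_pred0 add0n.
rewrite [count _ (bridges _ _ _ _)](eq_in_count
  (_ : {in _, _ =1 fun B : segment => a (1, B.2)})); last first.
  move=> /= A /(mem_bridges p0 q0 Rs Rt)[? /andP[lA _] _ _] /=.
  have [-> ->] : (p < A.1) = false /\ (p < A.2 + p) = true by lia.
  by rewrite addnK.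
rewrite bridgesE // (@count_zip_snd (fun j => a (1, j))) ?size_st //.
rewrite count_cat count_nseq addnA; congr (_ + _).
rewrite count_sorted_ends count_filter.
rewrite (count_split (fun A : segment => 1 < A.1) a); congr (_ + _).
  apply: eq_count => -[i j] /=; rewrite !addnK -{1}[p]add0n ltn_add2r.
  by case: (ltnP 1 i) => [/ltnW ->|]; rewrite ?andbF.
apply: eq_in_count => -[i j] /Ht[/= i1 _ _] /=; rewrite -leqNgt.
by case: (ltngtP i 1) i1 => [||-> //]; [case: i | rewrite !andbF].
Qed.

End Factors.

(** The restrictions to both sides of column p determine the factors. *)
Lemma concat_inj p q s t s' t' : 0 < p -> 0 < q ->
  in_R p s -> in_R q t -> in_R p s' -> in_R q t' ->
  perm_eq (concat_segments p q s t) (concat_segments p q s' t') ->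
  perm_eq s s' /\ perm_eq t t'.
Proof.
move=> p0 q0 Rs Rt Rs' Rt' e; split; apply/permP => a.
  apply: (@addIn (a (1, p) * q)).
  by rewrite -(count_restrict_left p0 q0 Rs Rt) (permP e) count_restrict_left.
apply: (@addIn (a (1, q) * p)).
by rewrite -(count_restrict_right p0 q0 Rs Rt) (permP e) count_restrict_right.
Qed.

(** * Suspended multisegments *)

Lemma in_R0_nil s : in_R 0 s -> s = [::].
Proof.
case: s => // A s /in_RP[/(_ A (mem_head _ _))[? ? ?] _].
by exfalso; lia.
Qed.

Lemma in_R1 s : in_R 1 s -> s = [:: (1, 1); (1, 1)].
Proof.
move=> /in_RP[Hs /(_ 1 isT) Hc].
have /all_pred1P -> : all (pred1 (1, 1)) s.
  by apply/allP => -[i j] /Hs[] /= *; apply/eqP; congr (_, _); lia.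
suff -> : size s = 2 by [].
rewrite -[RHS]Hc -count_predT; apply: eq_in_count => -[i j] /Hs[/= i1 lij j1].
by rewrite /in_segment /= (leq_trans i1 lij) (leq_trans lij j1).
Qed.

Definition desusp_segment n (A : segment) : segment :=
  (if A.1 == 1 then 1 else A.1.-1, if A.2 == n + 2 then n else A.2.-1).

Lemma susp_segmentK n A : segment_over n A -> desusp_segment n (susp_segment n A) = A.
Proof.
case: A => i j /and3P[/= i1 lij jn]; rewrite /desusp_segment /susp_segment /=.
by congr (_, _); [case: (i =P 1)|case: (j =P n)] => ?; case: eqP; lia.
Qed.

Lemma susp_segments_inj n s t : in_R n s -> in_R n t ->
  perm_eq (susp_segments n s) (susp_segments n t) -> perm_eq s t.
Proof.
have [->|n0] := posnP n; first by move=> /in_R0_nil -> /in_R0_nil ->.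
have desuspK u : in_R n u -> map (desusp_segment n) (map (susp_segment n) u) = u.
  move=> /andP[/allP Hu _]; rewrite -map_comp -[RHS]map_id.
  by apply/eq_in_map => A /Hu /susp_segmentK.
move=> Rs Rt; rewrite /susp_segments gtn_eqF // perm_cat2r.
by move/(perm_map (desusp_segment n)); rewrite !desuspK.
Qed.

Lemma cuts_susp n s k : in_R n s -> 0 < k < n ->
  cuts (n + 2) (susp_segments n s) k.+1 = cuts n s k.
Proof.
move=> /in_RP[Hs _] lk; rewrite /cuts (@count_susp (in_column k)); last by lia.
  by rewrite /in_column /=; lia.
by move=> A /Hs[]; rewrite /in_column /susp_segment /=; do 2 case: eqP => ?; lia.
Qed.

Lemma at_most_one_cut_desusp n s : in_R n s ->
  at_most_one_cut (n + 2) (susp_segments n s) -> at_most_one_cut n s.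
Proof.
move=> Rs /at_most_one_cutP C; apply/at_most_one_cutP => k lk.
by rewrite -(cuts_susp Rs) //; apply: C; lia.
Qed.

Lemma excessive_desusp n s : in_R n s ->
  excessive (susp_segments n s) -> excessive s.
Proof.
have [->|n0] := posnP n; first by move=> /in_R0_nil ->.
move=> Rs /(excessiveP (in_R_susp Rs)) E; have /in_RP[Hs _] := Rs.
apply/(excessiveP Rs) => A B C As Bs Cs h.
have mem_susp (X : segment) : X \in s -> susp_segment n X \in susp_segments n s.
  by move=> Xs; rewrite /susp_segments gtn_eqF // mem_cat map_f.
apply: (E _ _ _ (mem_susp _ As) (mem_susp _ Bs) (mem_susp _ Cs)).
have [a1 a2 a3] := Hs _ As; have [b1 b2 b3] := Hs _ Bs; have [c1 c2 c3] := Hs _ Cs.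
clear -h a1 a2 a3 b1 b2 b3 c1 c2 c3.
by rewrite /susp_segment /=; do 6 case: eqP => ?; lia.
Qed.

Lemma perm_cat_subset (T : eqType) (f s : seq T) :
  uniq f -> {subset f <= s} -> exists u, perm_eq s (u ++ f).
Proof.
move=> Uf sub.
have /count_subseqP[f' /perm_to_subseq[u su] ff'] : forall x, count_mem x f <= count_mem x s.
  by move=> x; rewrite count_uniq_mem //; case: (boolP (x \in f)) => // /sub;
    rewrite -has_pred1 has_count.
exists u; rewrite (perm_trans su) // perm_catC perm_cat2l.
by rewrite perm_sym.
Qed.

Lemma count_le1_absent (T : eqType) (a : pred T) (s u f : seq T) :
  perm_eq s (u ++ f) -> count a s <= 1 -> has a f -> {in u, forall x, ~~ a x}.
Proof.
move=> su; rewrite (permP su) count_cat has_count => c1 cf x xu.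
apply/negP => ax; suff: 0 < count a u by lia.
by rewrite -has_count; apply/hasP; exists x.
Qed.

(** The suspension of the empty multisegment does not follow the general
    pattern. Here [1, 1] and [2, 2] occur once each, because column 1 has at
    most one cut, and what remains is copies of [1, 2]. *)
Lemma desuspend0 s : in_R 2 s -> at_most_one_cut 2 s -> (1, 1) \in s ->
  perm_eq s (susp_segments 0 [::]).
Proof.
move=> Rs Cs m11; have /in_RP[Hs Hs'] := Rs.
have m22 : (2, 2) \in s.
  have [//|j mj] := end_start Rs _ m11.
  by have [/= _ j2 lj] := Hs _ mj; rewrite (_ : 2 = j) // in mj *; lia.
have [//||u su] := @perm_cat_subset _ [:: (1, 1); (2, 2)] s.
  by move=> A; rewrite !inE => /orP[] /eqP ->.
have C1 := at_most_one_cutP _ _ Cs 1 isT.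
have e1 : {in u, forall A : segment, A.2 != 1}.
  by apply: (count_le1_absent su); rewrite ?(count_ends Rs).
have s2 : {in u, forall A : segment, A.1 != 2}.
  by apply: (count_le1_absent su); rewrite ?(count_starts Rs).
have u12 (A : segment) : A \in u -> A = (1, 2).
  move=> Au; have [|? ? ?] := Hs A; first by rewrite (perm_mem su) mem_cat Au.
  have := e1 A Au; have := s2 A Au.
  by rewrite [A]surjective_pairing /= => *; congr (_, _); lia.
have /all_pred1P uE : all (pred1 (1, 2)) u by apply/allP => A /u12 ->; exact: eqxx.
have zu : size u = 2.
  have := Hs' 1 isT; rewrite (permP su) count_cat /=.
  rewrite -count_predT (@eq_in_count _ _ predT u); first by rewrite count_predT /in_segment /=; lia.
  by move=> A /u12 ->.
by rewrite (perm_trans su) // uE zu.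
Qed.

(** The three segments required, with [n + 2, n + 2] which follows the end of
    [1, n + 1], are those that the suspension adds. They use up the cuts at
    columns 1 and n + 1, so the other segments neither end at 1 or n + 1 nor
    start at 2 or n + 2, and [desusp_segment] shrinks them without loss. *)
Lemma desuspend n s : 0 < n -> in_R (n + 2) s -> at_most_one_cut (n + 2) s ->
  (1, 1) \in s -> (2, n + 2) \in s -> (1, n + 1) \in s ->
  exists t, in_R n t /\ perm_eq s (susp_segments n t).
Proof.
move=> n0 Rs Cs m11 m2n m1n; have /in_RP[Hs Hs'] := Rs.
have mnn : (n + 2, n + 2) \in s.
  have [|j mj] := end_start Rs _ m1n; first by lia.
  have [/= _ j2 lj] := Hs _ mj.
  by suff <- : ((n + 1).+1, j) = (n + 2, n + 2) by []; congr (_, _); lia.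
pose f := [:: (1, 1); (2, n + 2); (1, n + 1); (n + 2, n + 2)].
have [||u su] := @perm_cat_subset _ f s.
- by rewrite /= !inE !xpair_eqE; lia.
- by move=> A; rewrite !inE => /or4P[] /eqP ->.
have memu (A : segment) : A \in u -> A \in s by move=> Au; rewrite (perm_mem su) mem_cat Au.
have C := at_most_one_cutP _ _ Cs.
have e1 : {in u, forall A : segment, A.2 != 1}.
  by apply: (count_le1_absent su); rewrite ?(count_ends Rs) ?C //; lia.
have s2 : {in u, forall A : segment, A.1 != 2}.
  by apply: (count_le1_absent su); rewrite ?(count_starts Rs) ?C //=; lia.
have en : {in u, forall A : segment, A.2 != n + 1}.
  by apply: (count_le1_absent su); rewrite ?(count_ends Rs) ?C //=; lia.
have sn : {in u, forall A : segment, A.1 != (n + 1).+1}.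
  by apply: (count_le1_absent su); rewrite ?(count_starts Rs) ?C //=; lia.
have uP (A : segment) : A \in u -> [/\ 1 <= A.1, A.1 <= A.2, A.2 <= n + 2 &
    [/\ A.1 != 2, A.1 != n + 2, A.2 != 1 & A.2 != n + 1]].
  move=> Au; have [? ? ?] := Hs A (memu A Au); have := sn A Au.
  have := e1 A Au; have := en A Au; have := s2 A Au => *; split=> //; split=> //.
  by lia.
pose t := map (desusp_segment n) u.
have suspK : map (susp_segment n) t = u.
  rewrite /t -map_comp -[RHS]map_id; apply/eq_in_map => -[i j] /uP[/= ? ? ? [? ? ? ?]].
  rewrite /susp_segment /desusp_segment /=.
  by congr (_, _); [case: (i =P 1)|case: (j =P n + 2)] => ?; case: eqP; lia.
have tP (A : segment) : A \in t -> [/\ 1 <= A.1, A.1 <= A.2 & A.2 <= n].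
  case/mapP => -[i j] /uP[/= ? ? ? [? ? ? ?]] ->; rewrite /desusp_segment /=.
  by do 2 case: eqP => ?; split; lia.
have st : perm_eq s (susp_segments n t) by rewrite /susp_segments gtn_eqF // suspK.
exists t; split=> //; apply/in_RP; split=> [//|k lk].
have := Hs' k.+1 ltac:(lia); rewrite (permP st) (@count_susp (in_segment k)) //.
  by rewrite /in_segment /=; lia.
by move=> A /tP[]; rewrite /in_segment /susp_segment /=; do 2 case: eqP => ?; lia.
Qed.

(** * The arch at the beginning of an excessive multisegment *)

(** Let [2, j] be the segment starting at 2, and [1, m - 1] the longest segment
    starting at 1 among those ending before j. If column m were cut, the
    segment ending at m and the one starting at m + 1 would form a linked
    triple with [1, m - 1]. Two segments containing column m, neither of which
    contains the other, form a linked triple with [1, m - 1] if both start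
    after 1; otherwise the one that starts first starts at 1 and ends after j,
    and the other one completes [1, m - 1] and [2, j] to a linked triple. *)
Lemma first_arch n s : in_R n s -> at_most_one_cut n s -> excessive s ->
  1 < n -> (1, 1) \in s ->
  exists m j, [/\ 1 < m <= n, (1, m.-1) \in s, m <= j, (2, j) \in s &
                  m < n -> splits_at m s].
Proof.
move=> Rs Cs /(excessiveP Rs) E n1 m11; have /in_RP[Hs _] := Rs.
have [//|j mj] := end_start Rs _ m11.
have [_ /= lj jn] := Hs _ mj.
(* k = m - 1 *)
have [||k /andP[mk lkj] kmax] := @ex_maxnP (fun k => ((1, k) \in s) && (k < j)) j.
- by exists 1; rewrite m11.
- by move=> k /andP[_ /ltnW].
have [_ /= k0 _] := Hs _ mk.
have long l : (1, l) \in s -> k < l -> j <= l.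
  move=> ml lkl; rewrite leqNgt; apply/negP => llj.
  by have := kmax l; rewrite ml llj => /(_ isT); lia.
exists k.+1, j; split=> //; [by lia|move=> kn; split].
  move=> [i e] mA; apply/negP => /= /eqP ee; rewrite {e}ee in mA.
  have [/= i0 lik _] := Hs _ mA.
  have [i1|i1] := leqP i 1.
    (* [1, m] would be longer than [1, m - 1], or end at j together with [2, j] *)
    have ei : i = 1 by lia.
    rewrite {}ei in mA; have ej : j = k.+1 by have := long _ mA; lia.
    by rewrite -ej in mA; have := end_inj Rs Cs _ mA mj; lia.
  have [|l ml] := end_start Rs _ mA; first by lia.
  have [_ /= ll _] := Hs _ ml.
  by apply: (E _ _ _ mk mA ml); rewrite /=; lia.
have chain (A B : segment) : A \in s -> B \in s -> in_column k.+1 A ->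
    in_column k.+1 B -> A.1 < B.1 -> A.2 < B.2 -> False.
  case: A B => [i l] [i' l'] mA mB /= /andP[/= ? ?] /andP[/= ? ?] lii lll.
  have [/= i0 _ ln] := Hs _ mA; have [/= _ _ ln'] := Hs _ mB.
  have [i1|i1] := leqP i 1; last by apply: (E _ _ _ mk mA mB); rewrite /=; lia.
  have ei : i = 1 by lia.
  rewrite {}ei in mA lii; have jl : j <= l by apply: long => //; lia.
  have njl : j != l.
    by apply/negP => /eqP ejl; rewrite -ejl in mA; have := end_inj Rs Cs _ mA mj; lia.
  have ni2 : i' != 2.
    apply/negP => /eqP ei; rewrite ei in mB.
    by have := start_inj Rs Cs (k := 1) _ mB mj; lia.
  by apply: (E _ _ _ mk mj mB); rewrite /=; lia.
move=> A B; rewrite !mem_filter => /andP[cA mA] /andP[cB mB].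
have := chain A B mA mB cA cB; have := chain B A mB mA cB cA; rewrite /nested; lia.
Qed.

(** The segments [1, m - 1] and [2, j] both contain the columns from 2 to m - 2
    without being nested, and column m - 1 is cut. *)
Lemma arch_no_split p m j s : splits_at p s -> (1, m.-1) \in s -> (2, j) \in s ->
  m <= j -> 1 < p < m -> False.
Proof.
move=> [Hp chain] mA mB lmj lp; have := Hp _ mA; rewrite /= => np.
have := chain (1, m.-1) (2, j); rewrite !mem_filter mA mB /in_column /nested /=.
lia.
Qed.

(** * Unique decomposition of excessive multisegments *)

Definition segments (x : Eseg) : seq segment := Rmset (val (val x)).

Lemma segments_in_R x : in_R (degree x) (segments x).
Proof. exact: RsegP. Qed.

Lemma segments_cut x : at_most_one_cut (degree x) (segments x).
Proof. exact: (valP (val x)). Qed.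

Lemma segments_excessive x : excessive (segments x).
Proof. exact: (valP x). Qed.

Lemma Eseg_eq (x y : Eseg) :
  degree x = degree y -> perm_eq (segments x) (segments y) -> x = y.
Proof.
move=> dxy sxy; do 3 apply: val_inj.
rewrite [LHS]surjective_pairing [RHS]surjective_pairing; congr (_, _) => //.
by rewrite -[LHS]seq_mset_id -[RHS]seq_mset_id; apply/eq_seq_msetP.
Qed.

Lemma Eseg_of_segments n s : in_R n s -> at_most_one_cut n s -> excessive s ->
  exists x : Eseg, degree x = n /\ perm_eq (segments x) s.
Proof.
move=> Rs Cs Es; pose M : {mset segment}%mset := seq_mset s.
have Ms : perm_eq M s := perm_eq_seq_mset s.
have RM : in_R_pair (n, M) by rewrite /in_R_pair (in_R_perm _ Ms).
have CM : in_M (RSeg RM) by rewrite /in_M (at_most_one_cut_perm _ Ms).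
have EM : in_E (MSeg CM) by rewrite /in_E (excessive_perm Ms).
by exists (ESeg EM).
Qed.

Lemma segments_mul (x y : Eseg) : 0 < degree x -> 0 < degree y ->
  perm_eq (segments (x * y)%g)
    (concat_segments (degree x) (degree y) (segments x) (segments y)).
Proof.
move=> x0 y0; rewrite /segments !valM /Rmset /= /multisegment_cat.
by rewrite gtn_eqF // gtn_eqF // perm_eq_seq_mset.
Qed.

Lemma segments_suspension (x : Eseg) :
  perm_eq (segments (suspension x)) (susp_segments (degree x) (segments x)).
Proof. exact: perm_eq_seq_mset. Qed.

Lemma Eseg_degree0 (x : Eseg) : degree x = 0 -> x = 1%g.
Proof.
move=> x0; have d1 : degree (1%g : Eseg) = 0 by apply: degree1.
apply: Eseg_eq; first by rewrite x0 d1.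
have := segments_in_R x; have := segments_in_R 1%g.
by rewrite x0 d1 => /in_R0_nil -> /in_R0_nil ->.
Qed.

Lemma Eseg_degree1 (x y : Eseg) : degree x = 1 -> degree y = 1 -> x = y.
Proof.
move=> x1 y1; apply: Eseg_eq; first by rewrite x1 y1.
have := segments_in_R x; have := segments_in_R y.
by rewrite x1 y1 => /in_R1 -> /in_R1 ->.
Qed.

Lemma Eseg_mulI (x x' y y' : Eseg) : degree x = degree x' ->
  (x * y)%g = (x' * y')%g -> x = x' /\ y = y'.
Proof.
move=> dx e; have dy : degree y = degree y'.
  by apply: (@addnI (degree x)); rewrite {2}dx -!degreeM e.
have [x0|x0] := posnP (degree x).
  have x1 := Eseg_degree0 x0; have x'1 : x' = 1%g by apply: Eseg_degree0; rewrite -dx.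
  by move: e; rewrite x1 x'1 !mul1g.
have [y0|y0] := posnP (degree y).
  have y1 := Eseg_degree0 y0; have y'1 : y' = 1%g by apply: Eseg_degree0; rewrite -dy.
  by move: e; rewrite y1 y'1 !mulg1.
have := segments_mul x0 y0; rewrite e perm_sym.
have := segments_mul (x := x') (y := y'); rewrite -dx -dy => /(_ x0 y0) h' h.
have := perm_trans h h'; rewrite dx dy => /concat_inj[]; rewrite -?dx -?dy //.
- exact: segments_in_R.
- exact: segments_in_R.
- by rewrite dx; apply: segments_in_R.
- by rewrite dy; apply: segments_in_R.
by move=> sx sy; split; apply: Eseg_eq.
Qed.

Lemma Eseg_suspension_inj (x y : Eseg) : suspension x = suspension y -> x = y.
Proof.
move=> e; have dxy : degree x = degree y.
  by apply: (@addIn 2); rewrite -!degree_suspension e.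
apply: Eseg_eq => //; have := segments_suspension x; rewrite e perm_sym => sx.
apply: (susp_segments_inj (segments_in_R x)); first by rewrite dxy; apply: segments_in_R.
by rewrite (perm_trans sx) // dxy; apply: segments_suspension.
Qed.

Lemma splits_at_perm p s t : perm_eq s t -> splits_at p s -> splits_at p t.
Proof.
move=> e [Hp chain]; split=> [A At|A B]; first by apply: Hp; rewrite (perm_mem e).
rewrite !mem_filter -!(perm_mem e) => As Bs.
by apply: chain; rewrite mem_filter.
Qed.

Lemma Eseg_split (x : Eseg) m : 0 < m < degree x -> splits_at m (segments x) ->
  exists y z : Eseg, degree y = m /\ x = (y * z)%g.
Proof.
move=> /andP[m0 lm] splits; pose q := degree x - m.
have dx : degree x = m + q by rewrite subnKC // ltnW.
have q0 : 0 < q by rewrite subn_gt0.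
have := segments_in_R x; have := segments_cut x; have := segments_excessive x.
rewrite dx => Ex Cx Rx.
have [s [t [Rs Rt xst]]] := split_concat m0 q0 Rx Cx splits.
rewrite (at_most_one_cut_perm _ xst) in Cx; rewrite (excessive_perm xst) in Ex.
have [Cs Ct] := at_most_one_cut_factors m0 q0 Rs Rt Cx.
have [Es Et] := excessive_factors m0 q0 Rs Rt Ex.
have [y [dy ys]] := Eseg_of_segments Rs Cs Es.
have [z [dz zt]] := Eseg_of_segments Rt Ct Et.
exists y, z; split=> //; apply: Eseg_eq; first by rewrite degreeM dy dz.
rewrite (perm_trans xst) // perm_sym.
apply: perm_trans (segments_mul _ _) _; rewrite ?dy ?dz //.
exact: concat_segments_perm.
Qed.

Lemma Eseg_desuspend (x : Eseg) m : degree x = m -> 1 < m ->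
  (1, 1) \in segments x -> (1, m.-1) \in segments x -> (2, m) \in segments x ->
  exists a : Eseg, x = suspension a.
Proof.
move=> dx m1 x11 x1m x2m; pose n := m - 2.
have mn : m = n + 2 by rewrite subnK.
have := segments_in_R x; have := segments_cut x; have := segments_excessive x.
rewrite dx mn => Ex Cx Rx.
have [t [Rt xt]] : exists t, in_R n t /\ perm_eq (segments x) (susp_segments n t).
  have [n0|n0] := posnP n; last first.
    by apply: desuspend => //; [rewrite -mn|rewrite (_ : n + 1 = m.-1) // mn addn2 addn1].
  by exists [::]; rewrite n0 in Cx Rx *; split=> //; apply: desuspend0.
rewrite (at_most_one_cut_perm _ xt) in Cx; rewrite (excessive_perm xt) in Ex.
have [a [da au]] := Eseg_of_segments Rt (at_most_one_cut_desusp Rt Cx)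
                                      (excessive_desusp Rt Ex).
exists a; apply: Eseg_eq; first by rewrite degree_suspension da dx.
rewrite (perm_trans xt) // perm_sym; apply: perm_trans (segments_suspension _) _.
rewrite da /susp_segments; case: ifP => // _.
by rewrite perm_cat2r perm_map.
Qed.

(** The position where the initial arch of a product ends is visible in its
    segments. *)
Lemma segments_arch (a b : Eseg) : exists j,
  [/\ (1, 1) \in segments (suspension a * b)%g,
      (1, (degree a + 2).-1) \in segments (suspension a * b)%g,
      (2, j) \in segments (suspension a * b)%g, degree a + 2 <= j &
      0 < degree b -> splits_at (degree a + 2) (segments (suspension a * b)%g)].
Proof.
have [m11 m1 m2] : [/\ (1, 1) \in segments (suspension a),
    (1, (degree a + 2).-1) \in segments (suspension a) &
    (2, degree a + 2) \in segments (suspension a)].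
  rewrite !(perm_mem (segments_suspension a)) /susp_segments addn2 /=.
  case: ifP => [/eqP -> //|_]; rewrite !mem_cat !inE !xpair_eqE.
  by rewrite addn1 !eqxx !orbT.
have [b0|b0] := posnP (degree b).
  by exists (degree a + 2); rewrite (Eseg_degree0 b0) mulg1.
have dS : degree (suspension a) = degree a + 2 by apply: degree_suspension.
have RS := segments_in_R (suspension a); have Rb := segments_in_R b.
have S0 : 0 < degree (suspension a) by rewrite dS addn2.
have e := segments_mul S0 b0; rewrite dS in RS S0 e.
have [j [lj mj]] := extend_right S0 b0 RS Rb m2.
exists j; rewrite !(perm_mem e); split=> //; last 1 first.
- move=> _; apply: splits_at_perm (splits_concat S0 b0 RS Rb).
  by rewrite perm_sym.
- by apply: mem_concat_left; rewrite //= addn2.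
- by apply: mem_concat_left; rewrite //= addn2.
- exact: ltnW.
Qed.

Lemma Eseg_uniquely_decomposable : exists h : Eseg, uniquely_decomposable h.
Proof.
have [||| h [dh sh]] := @Eseg_of_segments 1 [:: (1, 1); (1, 1)]; try by [].
exists h; split=> //.
- exact: Eseg_degree0.
- by move=> y y' /Eseg_mulI[].
- move=> a a' b b' e.
  suff ea : degree a = degree a'.
    have [|/Eseg_suspension_inj //] := Eseg_mulI _ e.
    by rewrite !degree_suspension ea.
  (* the end of the shorter arch would split the longer one *)
  have shorter (c c' d d' : Eseg) : (suspension c * d = suspension c' * d')%g ->
      degree c < degree c' -> False.
    move=> ecc lcc; have dd := congr1 degree ecc.
    rewrite !degreeM !degree_suspension in dd.
    have [j [_ _ _ _ splits]] := segments_arch c d.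
    have [j' [_ m1 m2 lj' _]] := segments_arch c' d'.
    rewrite ecc in splits; apply: (arch_no_split (splits _) m1 m2 lj').
      by move: dd lcc; set k := degree c; set k' := degree c'; set l := degree d; lia.
    by move: lcc; set k := degree c; set k' := degree c'; lia.
  by case: (ltngtP (degree a) (degree a')) => // [/(shorter _ _ _ _ e)|/(shorter _ _ _ _ (esym e))].
- move=> y a b e; have [j [m11 _ _ _ _]] := segments_arch a b.
  have de := congr1 degree e; rewrite !degreeM dh degree_suspension in de.
  have y0 : 0 < degree y by move: de; lia.
  have h0 : 0 < degree h by rewrite dh.
  have := segments_mul h0 y0; rewrite e => p; rewrite (perm_mem p) in m11.
  have := (splits_concat h0 y0 (segments_in_R h) (segments_in_R y)).1 _ m11.
  by rewrite dh.
- move=> x x0; have [x1|x1] := eqVneq (degree x) 1.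
    by left; exists 1%g; rewrite mulg1; apply: Eseg_degree1.
  have [n dx] : exists n, degree x = n by exists (degree x).
  have n1 : 1 < n by rewrite -dx ltn_neqAle eq_sym x1.
  have Rx : in_R n (segments x) by rewrite -dx; apply: segments_in_R.
  have Cx : at_most_one_cut n (segments x) by rewrite -dx; apply: segments_cut.
  have /in_RP[Hs _] := Rx.
  have [m11|m11] := boolP ((1, 1) \in segments x).
    have [m [j [lm m1 lj mj splits]]] := first_arch Rx Cx (segments_excessive x) n1 m11.
    right; case: (ltnP m n) => mn.
      have [|y [z [dy ex]]] := @Eseg_split x m _ (splits mn).
        by rewrite dx; lia.
      have y0 : 0 < degree y by rewrite dy; lia.
      have z0 : 0 < degree z.
        by move: mn; rewrite -dx ex degreeM dy -{1}[m]addn0 ltn_add2l.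
      have Ry := segments_in_R y; have Rz := segments_in_R z.
      have e := segments_mul y0 z0; rewrite -ex dy in e.
      have nm : j != m by apply: (splits mn).1 mj.
      rewrite dy in Ry y0; rewrite !(perm_mem e) in m11 m1 mj.
      have [||||a ya] := Eseg_desuspend dy; first by lia.
      + by apply: mem_concat_before m11 _; rewrite /=; lia.
      + by apply: mem_concat_before m1 _; rewrite /=; lia.
      + by apply: (truncate_right y0 z0 Ry Rz mj); lia.
      by exists a, z; rewrite ex ya.
    have em : m = n by lia.
    have [_ _ /= jn] := Hs _ mj; have ej : j = n by lia.
    rewrite ej in mj; rewrite em in m1.
    have [a xa] := Eseg_desuspend dx n1 m11 m1 mj.
    by exists a, 1%g; rewrite mulg1.
  (* without [1, 1] column 1 is not cut, and all segments containing it start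
     at 1 *)
  left; have [||y [z [dy ex]]] := @Eseg_split x 1; first by rewrite dx; lia.
  - split=> [[i j] mA|A B].
      apply: contraNneq m11 => /= j1; rewrite j1 in mA.
      have [/= i0 i1 _] := Hs _ mA.
      by have ei : i = 1 by [lia]; rewrite ei in mA.
    rewrite !mem_filter => /andP[/andP[A1 _] As] /andP[/andP[B1 _] Bs].
    have [? _ _] := Hs _ As; have [? _ _] := Hs _ Bs.
    by rewrite /nested; lia.
  by exists z; rewrite ex (@Eseg_degree1 y h).
Qed.

(** A multisegment over [1, 1] has no linked triple, so it is excessive. *)
Lemma Mseg_degree1 (x y : Mseg) : degree x = 1 -> degree y = 1 -> x = y.
Proof.
have E (z : Mseg) : degree z = 1 -> in_E z.
  move=> z1; have Rz : in_R 1 (Rmset (val z)) by rewrite -z1; apply: RsegP.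
  by rewrite /in_E (in_R1 Rz).
move=> x1 y1; have := @Eseg_degree1 (ESeg (E x x1)) (ESeg (E y y1)) x1 y1.
by case.
Qed.

(** * The isomorphism *)

Theorem theorem5p5 :
  exists Phi : motzkin -> Eseg,
    [/\ graded_isomorphism Phi,
        commutes_with_suspension Phi,
        (forall Phi' : motzkin -> Eseg,
           graded_isomorphism Phi' -> commutes_with_suspension Phi' ->
           Phi' =1 Phi) &
        exists Psi : motzkin -> Mseg,
          [/\ [/\ graded_morphism Psi, injective Psi & commutes_with_suspension Psi],
              (forall Psi' : motzkin -> Mseg,
                 graded_morphism Psi' -> injective Psi' ->
                 commutes_with_suspension Psi' -> Psi' =1 Psi) &
              forall x : motzkin, val (Phi x) = Psi x]].
Proof.
have [h Eh] := Eseg_uniquely_decomposable.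
pose Phi := transport h motzkin_uniquely_decomposable.
have isoPhi : graded_isomorphism Phi := transport_isomorphism _ Eh.
have susPhi : commutes_with_suspension Phi := transport_suspension _ _.
have [[[Phi1 PhiM] Phid] [g [_ PhiK _]]] := isoPhi.
have grPsi : graded_morphism (fun x => val (Phi x) : Mseg).
  by split; first split=> [|x y]; rewrite ?Phi1 ?val1 ?PhiM ?valM.
have susPsi : commutes_with_suspension (fun x => val (Phi x) : Mseg).
  by move=> x; rewrite susPhi.
exists Phi; split=> // [Phi' [grPhi' _] susPhi'|].
  exact: graded_morphism_unique motzkin_uniquely_decomposable Eseg_degree1 _ _ _ _.
exists (fun x => val (Phi x)); split=> [|Psi' grPsi' _ susPsi'|//].
  by split=> // x y /val_inj /(can_inj PhiK).
exact: graded_morphism_unique motzkin_uniquely_decomposable Mseg_degree1 _ _ _ _.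
Qed.
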